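(* Let $K\in\mathcal K$. Assume that $A^s(K)$ is closed in measure and that $A_T(0;K)\cap L^0(\mathbb R^d_+;\mathcal F)=\{0\}$. Then, for all $\vartheta\in L^0(\mathbb R^d;\mathbb F)$, the set $\Gamma(\vartheta;K):=\{x\in\mathbb R^d:\vartheta\in A^s(x;K)\}$ satisfies $$\Gamma(\vartheta;K)=\Big\{x\in\mathbb R^d:\ \mathbb E\Big[\sum_{t=0}^T\vartheta_t\cdot Z_t\Big]\le\bar Z_0\cdot x\ \text{ for all } Z\in\mathcal D(K,\mathbb P)\text{ with }(Z\cdot\vartheta)^-\in L^1(\mathbb R;\mathbb F,\mathbb P)\Big\}.$$
   Context: Setting: $\mathbb T=\{0,\dots,T\}$ with an integer $T\ge1$; $(\Omega,\mathcal F,\mathbb P)$ is a complete probability space with filtration $\mathbb F=(\mathcal F_t)_{t\in\mathbb T}$, $\mathcal F_T=\mathcal F$, $\mathcal F_0$ trivial; $d\ge1$ is an integer. Relations between random variables (equality, inequality, membership in random sets) are understood $\mathbb P$-a.s. For a random set $E\subset\mathbb R^d$, $L^0(E;\mathbb F)$ (resp. $L^0(E;\mathcal G)$ for $\mathcal G\subset\mathcal F$) is the set of $\mathbb F$-adapted processes indexed by $\mathbb T$ (resp. $\mathcal G$-measurable random variables) with values in $E$; $L^1(E;\mathbb F,\mathbb P)$ is the subset of processes in $L^0(E;\mathbb F)$ that are $\mathbb P$-integrable at every $t\in\mathbb T$. The symbol $\cdot$ is the scalar product of $\mathbb R^d$; $Z\cdot\vartheta$ is the process $(Z_t\cdot\vartheta_t)_{t\in\mathbb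 T}$; $a^-$ is the negative part of $a$. A $\mathcal C$-valued process is a sequence $K=(K_t)_{t\in\mathbb T}$ of set-valued maps for which there is a countable sequence of $\mathbb R^d$-valued $\mathbb F$-adapted processes $X^n=(X^n_t)_{t\in\mathbb T}$ such that, for every $t\in\mathbb T$, $\mathbb P$-a.s. only a finite but non-zero number of the $X^n_t$ are different from zero, and $K_t=\mathrm{cone}\{X^n_t: n\in\mathbb N\}$ (the polyhedral convex cone generated by them). $\mathcal K$ is the set of $\mathcal C$-valued processes $K$ with $\mathbb R^d_+\setminus\{0\}\subset\mathrm{int}(K_t)$ for all $t\in\mathbb T$. The positive polar is $K^*_t(\omega)=\{y\in\mathbb R^d: x\cdot y\ge0\ \forall x\in K_t(\omega)\}$. For $K\in\mathcal K$ and $x\in\mathbb R^d$: $\mathcal A(K)=\{\xi\in L^0(\mathbb R^d;\mathbb F):\xi_t\in -K_t\ \forall t\in\mathbb T\}$; $V^{x,\xi}_t=x+\sum_{s=0}^t\xi_s$; $A(x;K)=\{V^{x,\xi}:\xi\in\mathcal A(K)\}$; $A_t(x;K)=\{V_t:V\in A(x;K)\}$; $A^s(x;K)=\{\vartheta\in L^0(\mathbb R^d;\mathbb F): \exists V\in A(x;K)\text{ with }V_t-\vartheta_t\in K_t\ \forall t\in\mathbb T\}$; $A^s(K)=A^s(0;K)$. A subset $B\subset L^0(\mathbb R^d;\mathbb F)$ is closed in measure if it is closed under convergence in probability when identified with a subset of $L^0(\mathbb R^{d\times(T+1)};\mathcal F)$: if $v^n\in B$ and $\lim_n\mathbb P[\sum_{t\in\mathbb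 T}\|v^n_t-v_t\|>\varepsilon]=0$ for all $\varepsilon>0$, then $v\in B$. $\mathcal D(K,\mathbb P)$ is the set of processes $Z\in L^1(\mathbb R^d_+;\mathbb F,\mathbb P)$ such that for all $t\in\mathbb T$: $Z_t\in K_t^*$ and $\bar Z_t:=\mathbb E[\sum_{s=t}^TZ_s\mid\mathcal F_t]\in K_t^*$. *)

(* Defs.v *)
From HB Require Import structures.
From mathcomp Require Import all_boot all_order all_algebra.
From mathcomp Require Import all_classical all_reals all_analysis.

Set Implicit Arguments.
Unset Strict Implicit.
Unset Printing Implicit Defensive.

Import Order.TTheory GRing.Theory Num.Theory.
Import numFieldNormedType.Exports.

Local Open Scope classical_set_scope.
Local Open Scope ring_scope.

(** ** Euclidean space, represented by row vectors *)

Definition dot (R : realType) (d : nat) (x y : 'rV[R]_d) : R :=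
  \sum_(i < d) x ord0 i * y ord0 i.

(* The library norm on matrices is the sup norm. *)
Definition enorm (R : realType) (d : nat) (x : 'rV[R]_d) : R :=
  Num.sqrt (dot x x).

Definition orthant (R : realType) (d : nat) : set 'rV[R]_d :=
  [set x | forall i, 0 <= x ord0 i].

Definition cone (R : realType) (d : nat) (A : set 'rV[R]_d) : set 'rV[R]_d :=
  [set x | exists (m : nat) (l : 'I_m -> R) (a : 'I_m -> 'rV[R]_d),
     [/\ forall i, 0 <= l i, forall i, A (a i) & x = \sum_(i < m) l i *: a i]].

Definition polar (R : realType) (d : nat) (C : set 'rV[R]_d) : set 'rV[R]_d :=
  [set y | forall x, C x -> 0 <= dot x y].

(** ** Sub-sigma-algebras, filtrations and conditional expectations *)

(* [g_sigma_algebraType G] carries the sigma-algebra generated by [G], which is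
   [G] itself when [G] is a sigma-algebra. *)
Definition measurable_wrt (Omega : pointedType) (R : realType)
    (G : set (set Omega)) (f : Omega -> R) : Prop :=
  measurable_fun [set: g_sigma_algebraType G] (f : g_sigma_algebraType G -> R).

Definition filtration (disp : measure_display) (Omega : measurableType disp)
    (T : nat) (F : 'I_T.+1 -> set (set Omega)) : Prop :=
  [/\ forall t, sigma_algebra setT (F t),
      forall t, F t `<=` measurable &
      forall s t : 'I_T.+1, (s <= t)%N -> F s `<=` F t].

(* Trivial up to null sets: this covers both the sigma-algebra {set0, setT} and
   its completion. *)
Definition trivial_sigma_algebra (disp : measure_display)
    (Omega : measurableType disp) (R : realType) (P : probability Omega R)
    (G : set (set Omega)) : Prop :=
  forall A, G A -> P A = 0%E \/ P A = 1%E.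

Definition is_condexp (disp : measure_display) (Omega : measurableType disp)
    (R : realType) (P : probability Omega R) (G : set (set Omega))
    (X Y : Omega -> R) : Prop :=
  [/\ measurable_wrt G Y,
      P.-integrable setT (EFin \o Y) &
      forall A, G A ->
        (\int[P]_(w in A) (Y w)%:E = \int[P]_(w in A) (X w)%:E)%E].

(* An arbitrary version of the conditional expectation; the default value is
   only used when there is none, hence never for an integrable [X]. *)
Definition condexp (disp : measure_display) (Omega : measurableType disp)
    (R : realType) (P : probability Omega R) (G : set (set Omega))
    (X : Omega -> R) : Omega -> R :=
  xget (cst 0) [set Y | is_condexp P G X Y].

Definition condexp_vec (disp : measure_display) (Omega : measurableType disp)
    (R : realType) (P : probability Omega R) (d : nat) (G : set (set Omega))
    (X : Omega -> 'rV[R]_d) : Omega -> 'rV[R]_d :=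
  fun w => \row_(i < d) condexp P G (fun w' => X w' ord0 i) w.

(** ** Spaces of random variables and processes

   Elements are functions, not classes of functions; membership in a random
   set holds almost surely. *)

Definition process (Omega : Type) (R : realType) (T d : nat) : Type :=
  'I_T.+1 -> Omega -> 'rV[R]_d.

Definition L0 (disp : measure_display) (Omega : measurableType disp)
    (R : realType) (P : probability Omega R) (d : nat) (G : set (set Omega))
    (E : Omega -> set 'rV[R]_d) : set (Omega -> 'rV[R]_d) :=
  [set X : Omega -> 'rV[R]_d |
   (forall i, measurable_wrt G (fun w => X w ord0 i)) /\
   \forall w \ae P, E w (X w)].

Definition L0_process (disp : measure_display) (Omega : measurableType disp)
    (R : realType) (P : probability Omega R) (T d : nat)
    (F : 'I_T.+1 -> set (set Omega)) (E : Omega -> set 'rV[R]_d) :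
    set (process Omega R T d) :=
  [set X : process Omega R T d | forall t, L0 P (F t) E (X t)].

Definition L1_process (disp : measure_display) (Omega : measurableType disp)
    (R : realType) (P : probability Omega R) (T d : nat)
    (F : 'I_T.+1 -> set (set Omega)) (E : Omega -> set 'rV[R]_d) :
    set (process Omega R T d) :=
  [set X : process Omega R T d | L0_process P F E X /\
     forall t i, P.-integrable setT (EFin \o (fun w => X t w ord0 i))].

Definition L1_real_process (disp : measure_display)
    (Omega : measurableType disp) (R : realType) (P : probability Omega R)
    (T : nat) (F : 'I_T.+1 -> set (set Omega)) : set ('I_T.+1 -> Omega -> R) :=
  [set X : 'I_T.+1 -> Omega -> R | forall t, measurable_wrt (F t) (X t) /\
     P.-integrable setT (EFin \o X t)].

(* Processes that agree almost surely are identified in L^0, so a limit only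
   has to agree almost surely with an element of [B].  The limit is not assumed
   to be adapted. *)
Definition closed_in_measure (disp : measure_display)
    (Omega : measurableType disp) (R : realType) (P : probability Omega R)
    (T d : nat) (B : set (process Omega R T d)) : Prop :=
  forall (v : nat -> process Omega R T d) (v0 : process Omega R T d),
    (forall n, B (v n)) ->
    (forall t, L0 P measurable (cst setT) (v0 t)) ->
    (forall eps : R, 0 < eps ->
       P [set w | eps < \sum_(t < T.+1) enorm (v n t w - v0 t w)]
         @[n --> \oo] --> 0%E) ->
    exists2 u, B u & forall t, \forall w \ae P, u t w = v0 t w.

(** ** Set-valued processes *)

Definition set_process (Omega : Type) (R : realType) (T d : nat) : Type :=
  'I_T.+1 -> Omega -> set 'rV[R]_d.

Definition C_valued (disp : measure_display) (Omega : measurableType disp)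
    (R : realType) (P : probability Omega R) (T d : nat)
    (F : 'I_T.+1 -> set (set Omega)) : set (set_process Omega R T d) :=
  [set K : set_process Omega R T d | exists2 X : nat -> process Omega R T d,
     forall n, L0_process P F (cst setT) (X n) &
     forall t, \forall w \ae P,
       [/\ finite_set [set n | X n t w != 0],
           [set n | X n t w != 0] !=set0 &
           K t w = cone (range (fun n => X n t w))]].

Definition calK (disp : measure_display) (Omega : measurableType disp)
    (R : realType) (P : probability Omega R) (T d : nat)
    (F : 'I_T.+1 -> set (set Omega)) : set (set_process Omega R T d) :=
  [set K : set_process Omega R T d | C_valued P F K /\
     forall t, \forall w \ae P,
       @orthant R d `\` [set 0] `<=` interior (K t w)].

(** ** Portfolios *)

Definition strategies (disp : measure_display) (Omega : measurableType disp)
    (R : realType) (P : probability Omega R) (T d : nat)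
    (F : 'I_T.+1 -> set (set Omega)) (K : set_process Omega R T d) :
    set (process Omega R T d) :=
  [set xi : process Omega R T d | L0_process P F (cst setT) xi /\
     forall t, \forall w \ae P, K t w (- xi t w)].

Definition wealth (Omega : Type) (R : realType) (T d : nat) (x : 'rV[R]_d)
    (xi : process Omega R T d) : process Omega R T d :=
  fun t w => x + \sum_(s < T.+1 | (s <= t)%N) xi s w.

Definition attainable (disp : measure_display) (Omega : measurableType disp)
    (R : realType) (P : probability Omega R) (T d : nat)
    (F : 'I_T.+1 -> set (set Omega)) (x : 'rV[R]_d)
    (K : set_process Omega R T d) : set (process Omega R T d) :=
  [set wealth x xi | xi in strategies P F K].

Definition attainable_at (disp : measure_display) (Omega : measurableType disp)
    (R : realType) (P : probability Omega R) (T d : nat)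
    (F : 'I_T.+1 -> set (set Omega)) (t : 'I_T.+1) (x : 'rV[R]_d)
    (K : set_process Omega R T d) : set (Omega -> 'rV[R]_d) :=
  [set V t | V in attainable P F x K].

Definition superhedgeable (disp : measure_display)
    (Omega : measurableType disp) (R : realType) (P : probability Omega R)
    (T d : nat) (F : 'I_T.+1 -> set (set Omega)) (x : 'rV[R]_d)
    (K : set_process Omega R T d) : set (process Omega R T d) :=
  [set theta : process Omega R T d | L0_process P F (cst setT) theta /\
     exists2 V, attainable P F x K V &
       forall t, \forall w \ae P, K t w (V t w - theta t w)].

(** ** Dual processes *)

Definition Zbar (disp : measure_display) (Omega : measurableType disp)
    (R : realType) (P : probability Omega R) (T d : nat)
    (F : 'I_T.+1 -> set (set Omega)) (Z : process Omega R T d) :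
    process Omega R T d :=
  fun t => condexp_vec P (F t) (fun w => \sum_(s < T.+1 | (t <= s)%N) Z s w).

Definition calD (disp : measure_display) (Omega : measurableType disp)
    (R : realType) (P : probability Omega R) (T d : nat)
    (F : 'I_T.+1 -> set (set Omega)) (K : set_process Omega R T d) :
    set (process Omega R T d) :=
  [set Z : process Omega R T d | L1_process P F (cst (@orthant R d)) Z /\
     forall t, (\forall w \ae P, polar (K t w) (Z t w)) /\
               (\forall w \ae P, polar (K t w) (Zbar P F Z t w))].

Definition Gamma (disp : measure_display) (Omega : measurableType disp)
    (R : realType) (P : probability Omega R) (T d : nat)
    (F : 'I_T.+1 -> set (set Omega)) (theta : process Omega R T d)
    (K : set_process Omega R T d) : set 'rV[R]_d :=
  [set x | superhedgeable P F x K theta].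

(* Main.v *)
Require Import Defs.
From HB Require Import structures.
From mathcomp Require Import all_boot all_order all_algebra.
From mathcomp Require Import all_classical all_reals all_analysis.
From mathcomp Require Import measurable_realfun ring lra.

Set Implicit Arguments.
Unset Strict Implicit.
Unset Printing Implicit Defensive.

Import Order.TTheory GRing.Theory Num.Theory.
Import numFieldNormedType.Exports.

Local Open Scope classical_set_scope.
Local Open Scope ring_scope.

(** A superhedging price dominates every dual value.  Let [V] be the portfolio
    that superhedges [theta] from [x], let [Z] be a dual process, and put
    [S_t = sum_(u < t) Z_u . V_u + V_t . Zbar_t].  Trades lie in [- K_t] and
    [Zbar_t] in its polar, hence [S_(t+1) <= S_t + V_t . N_t] where
    [N_t = Z_t + Zbar_(t+1) - Zbar_t] has conditional mean zero given [F_t].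
    So [S] is morally a supermartingale, but [V_t] is unbounded and [V_t . N_t]
    may fail to be integrable.  What saves the argument is that the terminal
    value dominates [sum_t theta_t . Z_t], whose negative part is integrable:
    restricting to [|V_t| <= n] and letting [n] grow carries the integrability
    of the negative part backwards ([le_integral_negpart]) and makes the
    expectation nonincreasing ([le_integral_supermartingale]).  As
    [S_0 <= x . Zbar_0] and [F_0] is trivial, [superhedge_integral_le] and
    [trivial_integral_le] give the bound.

    Conversely, let [x] satisfy all the dual inequalities.  The processes that
    can be superhedged from 0 form a convex cone, and the weights
    [rho_t = 1 / (1 + |theta_t|^2)] put [theta - x] in the Hilbert space with
    squared norm [E sum_t rho_t |f_t|^2].  Closedness in measure makes the cone closed
    there ([hedges_complete]), so [theta - x] has a projection [p] on it
    ([hedges_projection]); let [r = theta - x - p].  The process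
    [Z_t = rho_t r_t] is adapted, because the weights are, and [r] has a
    nonpositive inner product with every element of the cone.  Testing this on
    positions taken at time [t] alone puts [Z_t] in the polar of [K_t], and
    testing it on positions bought at [t] and held until the horizon does the
    same for [Zbar_t] ([polar_of_tests]).  The dual inequality for this [Z] reads [<r, theta - x> <= 0], while
    [<r, theta - x> = |r|^2] since [r] is orthogonal to [p].  Hence [r = 0] and
    [theta - x = p] can be superhedged from 0. *)

(** * Sub-sigma-algebras, conditional expectations and one-step inequalities *)

Section SubSigmaAlgebra.
Context (disp : measure_display) (Omega : measurableType disp) (R : realType).
Context (P : probability Omega R).
Implicit Types (f g X Y : Omega -> R) (G H : set (set Omega)).

Lemma measurable_wrt_sub G H f :
  G `<=` H -> measurable_wrt G f -> measurable_wrt H f.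
Proof.
move=> GH mf _ B mB.
by apply: (sub_sigma_algebra2 GH); exact: mf.
Qed.

Lemma measurable_wrt_measurable G f : G `<=` measurable ->
  measurable_wrt G f -> measurable_fun setT f.
Proof.
move=> Gm mf _ B mB.
rewrite -(sigma_algebra_id (@sigma_algebra_measurable _ Omega)).
by apply: (sub_sigma_algebra2 Gm); exact: mf.
Qed.

Lemma measurable_wrt_preimage G f (B : set R) : sigma_algebra setT G ->
  measurable_wrt G f -> measurable B -> G (f @^-1` B).
Proof.
move=> sG mf mB; have := mf measurableT B mB.
by rewrite setTI measurable_g_measurableTypeE.
Qed.

Section FixedSubAlgebra.
Context (G : set (set Omega)) (sG : sigma_algebra setT G)
  (Gm : G `<=` measurable).

Let GT : measurableType _ := g_sigma_algebraType G.

Lemma measurable_to_sub : measurable_fun [set: Omega] (id : Omega -> GT).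
Proof.
move=> _ B mB; rewrite setTI; apply: Gm; move: mB.
by rewrite /GT measurable_g_measurableTypeE.
Qed.

(** Radon-Nikodym, applied on the measurable space that carries only [G]: the
    charge with density [X] and the probability are pushed forward along the
    identity map to that space, and the density found there is [G]-measurable. *)
Lemma condexp_exists X : P.-integrable setT (EFin \o X) ->
  exists Y, is_condexp P G X Y.
Proof.
move=> iX.
pose id' : {mfun Omega >-> GT} :=
  HB.pack (id : Omega -> GT) (isMeasurableFun.Build _ _ _ _ _ measurable_to_sub).
pose mu : {finite_measure set GT -> \bar R} := distribution P id'.
pose nu : {charge set GT -> \bar R} :=
  measure_function_pushforward__canonical__charge_Charge
    (induced_charge iX) measurable_to_sub.
have nul (A : set Omega) : measurable A -> P A = 0%E ->
    (\int[P]_(w in A) (EFin \o X) w = 0)%E.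
  move=> mA PA; apply: null_set_integral => //.
  by apply: measurable_funTS; exact: measurable_int iX.
have dom : nu `<< mu.
  apply: (null_content_dominatesP _ _).2 => A mA muA0; apply: (nul A) => //.
  by have := measurable_to_sub measurableT mA; rewrite setTI.
have iY := Radon_Nikodym_integrable dom.
have fY := fun x => Radon_Nikodym_fin_num x dom.
have EY := fun A => @Radon_Nikodym_integral _ _ _ nu mu A dom.
set Y := Radon_Nikodym nu mu in iY fY EY.
have mY : measurable_fun [set: GT] (fine \o Y : GT -> R).
  by apply: measurableT_comp => //; exact: measurable_int iY.
exists (fine \o Y).
have YE : (EFin \o (fine \o Y)) = Y by apply/funext => w /=; rewrite fineK.
have iYP : P.-integrable setT Y.
  apply/integrableP; split.
    apply: (measurableT_comp (f := Y)) measurable_to_sub.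
    exact: measurable_int iY.
  move/integrableP : iY => [mY' ]; rewrite ge0_integral_pushforward//.
  by apply: measurableT_comp.
split => //; first by rewrite YE.
move=> A GA.
have mA : measurable (A : set GT).
  by rewrite measurable_g_measurableTypeE.
under eq_integral do rewrite -[(_)%:E]/((EFin \o (fine \o Y)) _) YE.
have := EY A mA.
rewrite integral_pushforward//; first exact: measurable_int iY.
by apply: integrableS iYP => //; exact: Gm.
Qed.

(** The conditional expectation of [D] given [G] vanishes; stated on events so
    that no version has to be chosen. *)
Definition mean_zero (D : Omega -> R) :=
  P.-integrable setT (EFin \o D) /\
  forall A, G A -> (\int[P]_(w in A) (D w)%:E = 0)%E.

Lemma integrable_boundedM (g D : Omega -> R) (M : R) :
  measurable_fun setT g -> (forall w, `|g w| <= M) ->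
  P.-integrable setT (EFin \o D) ->
  P.-integrable setT (EFin \o (fun w => g w * D w)).
Proof.
move=> mg gM iD.
apply: (@le_integrable _ _ _ _ _ measurableT _ (fun w => M%:E * (D w)%:E)%E).
- apply/measurable_EFinP; apply: measurable_funM => //.
  by apply/measurable_EFinP; exact: measurable_int iD.
- move=> w _ /=; rewrite lee_fin !normrM ler_wpM2r//.
  by apply: le_trans (gM w) _; exact: ler_norm.
- exact: integrableZl.
Qed.

Lemma integral_indicM (A : set Omega) (D : Omega -> R) :
  (\int[P]_w (\1_A w * D w)%:E = \int[P]_(w in A) (D w)%:E)%E.
Proof.
rewrite [RHS]integral_mkcond; apply: eq_integral => w _.
by rewrite patchE indicE; case: ifP; rewrite ?mul1r ?mul0r.
Qed.

Lemma measurable_sub_set (A : set Omega) :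
  measurable (A : set GT) -> G A.
Proof. by rewrite measurable_g_measurableTypeE. Qed.

Import HBNNSimple.

Lemma mean_zero_simple (D : Omega -> R) (f : {nnsfun GT >-> R}) :
  mean_zero D -> (\int[P]_w (f w * D w)%:E = 0)%E.
Proof.
move=> [iD D0].
have mA y : G (f @^-1` [set y]).
  by apply: measurable_sub_set; exact: measurable_funPTI.
under eq_integral => w _.
  rewrite fimfunEord mulr_suml -sumEFin.
  under eq_bigr do rewrite -mulrA EFinM.
  over.
have iAD y : P.-integrable setT (fun w => (\1_(f @^-1` [set y]) w * D w)%:E).
  apply: (@integrable_boundedM _ _ 1) => //.
    by apply: measurable_indic; exact: Gm.
  by move=> w; rewrite indicE; case: (_ \in _); rewrite ?normr1 ?normr0.
rewrite integral_sum//; last by move=> i; exact: integrableZl.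
by apply: big1 => i _; rewrite integralZl// integral_indicM D0// mule0.
Qed.

(** Dominated convergence along the simple [G]-measurable approximations of [g]
    transfers the identity from events to bounded test functions. *)
Lemma mean_zero_ge0_test (D g : Omega -> R) (M : R) :
  mean_zero D -> measurable_wrt G g -> (forall w, 0 <= g w <= M) ->
  (\int[P]_w (g w * D w)%:E = 0)%E.
Proof.
move=> D0 mg g0M; have [iD _] := D0.
have mgE : measurable_fun [set: GT] (EFin \o (g : GT -> R)).
  exact/measurable_EFinP.
pose f := nnsfun_approx measurableT mgE.
have fg w : (f n w)%:E @[n --> \oo] --> (g w)%:E.
  apply: (@cvg_nnsfun_approx _ _ _ _ measurableT _ mgE) => // x _.
  by rewrite lee_fin; case/andP: (g0M x).
have fle n w : f n w <= g w.
  have nd : nondecreasing_seq (fun i => (f i w)%:E).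
    by move=> i j ij; rewrite lee_fin; exact/lefP/nd_nnsfun_approx.
  rewrite -lee_fin.
  rewrite (cvg_unique (@ereal_hausdorff R) (fg w) (ereal_nondecreasing_cvgn nd)).
  by apply: ereal_sup_ubound; exists n.
have mf n : measurable_fun setT (f n : Omega -> R).
  apply: (measurable_wrt_measurable Gm); exact: measurable_funP.
have mD : measurable_fun setT D.
  by apply/measurable_EFinP; exact: measurable_int iD.
have [] := @dominated_convergence _ _ _ P setT measurableT
  (fun n w => (f n w * D w)%:E) (fun w => (g w * D w)%:E)
  (fun w => M%:E * `|(D w)%:E|)%E.
- move=> n; apply/measurable_EFinP; exact: measurable_funM.
- apply/measurable_EFinP; apply: measurable_funM => //.
  exact: measurable_wrt_measurable mg.
- apply: aeW => w _; under eq_fun do rewrite EFinM; rewrite EFinM.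
  by apply: cvgeZr.
- by apply: integrableZl => //; exact: integrable_abse.
- apply: aeW => w n _; rewrite EFinM abseM lee_wpmul2r//.
  rewrite gee0_abs ?lee_fin//; apply: le_trans (fle _ _) _.
  by case/andP: (g0M w).
move=> _ _ /cvg_lim <-//; apply: cvg_lim => //.
rewrite (_ : (fun _ => _) = cst 0%E); first exact: cvg_cst.
by apply/funext => n; rewrite mean_zero_simple.
Qed.

Lemma mean_zero_test (D g : Omega -> R) (M : R) :
  mean_zero D -> measurable_wrt G g -> (forall w, `|g w| <= M) ->
  (\int[P]_w (g w * D w)%:E = 0)%E.
Proof.
move=> D0 mg gM; have [iD _] := D0.
have mgp : measurable_wrt G g^\+ by exact: measurable_funrpos.
have mgn : measurable_wrt G g^\- by exact: measurable_funrneg.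
have bp w : 0 <= g^\+ w <= M.
  rewrite funrpos_ge0/= /funrpos ge_max (le_trans (ler_norm _) (gM w))/=.
  exact: le_trans (gM w).
have bn w : 0 <= g^\- w <= M.
  rewrite funrneg_ge0/= /funrneg ge_max; apply/andP; split.
    by apply: le_trans (ler_norm _) _; rewrite normrN.
  exact: le_trans (gM w).
have ip (h : Omega -> R) : measurable_wrt G h -> (forall w, 0 <= h w <= M) ->
    P.-integrable setT (EFin \o (fun w => h w * D w)).
  move=> mh hM; apply: (@integrable_boundedM _ _ M) => //.
    exact: measurable_wrt_measurable mh.
  by move=> w; case/andP: (hM w) => h0 ?; rewrite ger0_norm.
transitivity (\int[P]_w ((g^\+ w * D w)%:E - (g^\- w * D w)%:E))%E.
  apply: eq_integral => w _; rewrite -EFinB -mulrBl; congr (_ * _)%:E.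
  by rewrite -[in LHS](funrposBneg g).
rewrite integralB//; [|exact: ip|exact: ip].
by rewrite !(@mean_zero_ge0_test _ _ M)// sube0.
Qed.

(** The product [dot v N] is only controlled where [v] is bounded, so the
    conclusion is localized to such an event of [G]. *)
Lemma mean_zero_local_dot d (v N : Omega -> 'rV[R]_d) (C : set Omega) (M : R) :
  (forall i, measurable_wrt G (fun w => v w ord0 i)) ->
  (forall i, mean_zero (fun w => N w ord0 i)) ->
  G C -> (forall w i, C w -> `|v w ord0 i| <= M) -> 0 <= M ->
  P.-integrable C (fun w => (dot (v w) (N w))%:E) /\
  (\int[P]_(w in C) (dot (v w) (N w))%:E = 0)%E.
Proof.
move=> mv N0 GC vM M0.
have mC : measurable C by exact: Gm.
have iE (i : 'I_d) : P.-integrable setT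
    (EFin \o (fun w => (\1_C w * v w ord0 i) * N w ord0 i)) /\
    (\int[P]_w ((\1_C w * v w ord0 i) * N w ord0 i)%:E = 0)%E.
  have mg : measurable_wrt G (fun w => \1_C w * v w ord0 i).
    apply: measurable_funM; last exact: mv.
    apply: measurable_indic; rewrite measurable_g_measurableTypeE//.
  have gM w : `|\1_C w * v w ord0 i| <= M.
    rewrite indicE; have [wC|_] := boolP (w \in C); last by rewrite mul0r normr0.
    by rewrite mul1r; apply: vM; exact: set_mem.
  split; last exact: mean_zero_test (N0 i) mg gM.
  apply: integrable_boundedM gM _; last by case: (N0 i).
  exact: measurable_wrt_measurable mg.
have iC (i : 'I_d) : P.-integrable C (fun w => (v w ord0 i * N w ord0 i)%:E).
  have := integrableS measurableT mC (@subsetT _ C) (iE i).1.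
  apply: eq_integrable => // w wC /=.
  by rewrite indicE wC mul1r.
have -> : (fun w => (dot (v w) (N w))%:E) =
    (fun w => \sum_(i < d) (v w ord0 i * N w ord0 i)%:E)%E.
  by apply/funext => w; rewrite sumEFin.
split; first by apply: integrable_sum.
rewrite integral_sum//; apply: big1 => i _.
rewrite -(integral_indicM C (fun w => v w ord0 i * N w ord0 i)) -[RHS](iE i).2.
apply: eq_integral => w _.
by rewrite mulrA.
Qed.

(** The inequality is arranged with nonnegative integrands on both sides, so
    that infinite values are harmless.  On the events where [v] is bounded by [n] the term
    [dot v N] has integral 0; these events increase to [A] and monotone
    convergence applies. *)
Lemma supermartingale_step_local d (S S' : Omega -> R) (v N : Omega -> 'rV[R]_d)
    (A : set Omega) :
  measurable_wrt G S -> measurable_fun setT S' ->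
  (forall i, measurable_wrt G (fun w => v w ord0 i)) ->
  (forall i, mean_zero (fun w => N w ord0 i)) ->
  (\forall w \ae P, S' w <= S w + dot (v w) (N w)) -> G A ->
  (\int[P]_(w in A) (S'^\+ w + S^\- w)%:E <=
   \int[P]_(w in A) (S^\+ w + S'^\- w)%:E)%E.
Proof.
move=> mS mS' mv N0 SS' GA.
have mST := measurable_wrt_measurable Gm mS.
pose U w := S'^\+ w + S^\- w.
pose W w := S^\+ w + S'^\- w.
have U0 w : 0 <= U w by rewrite addr_ge0.
have W0 w : 0 <= W w by rewrite addr_ge0.
have mU : measurable_fun setT (EFin \o U).
  apply/measurable_EFinP; apply: measurable_funD.
    exact: measurable_funrpos.
  exact: measurable_funrneg.
have mW : measurable_fun setT (EFin \o W).
  apply/measurable_EFinP; apply: measurable_funD.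
    exact: measurable_funrpos.
  exact: measurable_funrneg.
pose m w : R := \sum_(i < d) `|v w ord0 i|.
pose B (n : nat) := A `&` [set w | m w <= n%:R].
have GT_ (C : set GT) : measurable C <-> G C.
  by rewrite measurable_g_measurableTypeE.
have GB n : G (B n).
  apply/GT_; apply: measurableI; first exact/GT_.
  have mm : measurable_wrt G m.
    by apply: measurable_sum => i; apply: measurableT_comp => //; exact: mv.
  apply/GT_; apply: (measurable_wrt_preimage (B := [set x | x <= n%:R])) => //.
  by rewrite -set_itvNyc; exact: measurable_itv.
have mB n : measurable (B n) by exact: Gm.
have BA n : B n `<=` A by move=> w [].
have Bbound n w i : B n w -> `|v w ord0 i| <= n%:R.
  move=> [_]; apply: le_trans.
  by rewrite /m (bigD1 i)//= lerDl sumr_ge0.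
have UB : \bigcup_n B n = A.
  apply/seteqP; split => [w [n _ []]//|w Aw].
  exists (Num.truncn (m w)).+1 => //; split => //.
  exact/ltW/truncnS_gt.
(* Adding the positive and negative parts of dot v N, which have the same
   finite integral over B n, turns the hypothesis into an inequality between
   nonnegative functions. *)
have key n : (\int[P]_(w in B n) (U w)%:E <= \int[P]_(w in A) (W w)%:E)%E.
  have [iX X0] := mean_zero_local_dot mv N0 (GB n) (@Bbound n) (ler0n _ _).
  set X := (fun w => (dot (v w) (N w))%:E) in iX.
  have mX := measurable_int _ iX.
  apply: (@le_trans _ _ (\int[P]_(w in B n) (W w)%:E)%E); last first.
    apply: ge0_subset_integral => //; first exact: Gm.
    - exact: measurable_funTS.
    - by move=> w _; rewrite lee_fin.
  have fp := integrable_pos_fin_num (mB n) iX.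
  have fn := integrable_neg_fin_num (mB n) iX.
  have XE : (\int[P]_(w in B n) X^\+ w = \int[P]_(w in B n) X^\- w)%E.
    move: X0; rewrite -/X integralE -(fineK fp) -(fineK fn) -EFinB.
    by case=> /eqP; rewrite subr_eq0 => /eqP ->.
  rewrite -(@leeD2rE _ (\int[P]_(w in B n) X^\- w)%E)// -{2}XE.
  rewrite -!ge0_integralD//; try (by move=> w _; rewrite ?lee_fin);
    try exact: measurable_funTS; last 2 first.
  - exact: measurable_funepos.
  - exact: measurable_funeneg.
  apply: ae_ge0_le_integral => //.
  - by move=> w _; rewrite adde_ge0// lee_fin.
  - apply: emeasurable_funD; first exact: measurable_funTS.
    exact: measurable_funeneg.
  - by move=> w _; rewrite adde_ge0// lee_fin.
  - apply: emeasurable_funD; first exact: measurable_funTS.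
    exact: measurable_funepos.
  apply: filterS SS' => w Sw _.
  rewrite funeposE funenegE /X /= -!EFin_max -!EFinD lee_fin /U /W.
  rewrite /funrpos /funrneg; move: Sw; set a := S' w; set b := S w.
  set c := dot _ _; have pn (x : R) : Num.max x 0 - Num.max (- x) 0 = x.
    by have := funrposBneg (fun _ : unit => x) => /(congr1 (@^~ tt)).
  by move: (pn a) (pn b) (pn c); lra.
have ndB : nondecreasing_seq B.
  move=> p n pn; apply/subsetPset => w [Aw mw]; split => //.
  by apply: le_trans mw _; rewrite ler_nat.
have cv := @ge0_nondecreasing_set_cvg_integral _ _ _ B (EFin \o U) P ndB mB
  (fun n => measurable_funTS mU) (fun n w _ => U0 w).
rewrite UB in cv.
rewrite -(cvg_lim _ cv)//.
apply: lime_le; first by apply/cvg_ex; eexists; apply: cv.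
by apply: nearW => n; exact: key.
Qed.

(** Localize to the event [S < 0], where the positive part of [S] vanishes. *)
Lemma le_integral_negpart (S S' : Omega -> R) d (v N : Omega -> 'rV[R]_d) :
  measurable_wrt G S -> measurable_fun setT S' ->
  (forall i, measurable_wrt G (fun w => v w ord0 i)) ->
  (forall i, mean_zero (fun w => N w ord0 i)) ->
  (\forall w \ae P, S' w <= S w + dot (v w) (N w)) ->
  (\int[P]_w (S^\- w)%:E <= \int[P]_w (S'^\- w)%:E)%E.
Proof.
move=> mS mS' mv N0 SS'.
have mST := measurable_wrt_measurable Gm mS.
have GA : G (S @^-1` [set x | x < 0]).
  apply: measurable_wrt_preimage => //.
  by rewrite -set_itvNyo; exact: measurable_itv.
set A := S @^-1` _ in GA.
have mA : measurable A by exact: Gm.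
have := supermartingale_step_local mS mS' mv N0 SS' GA.
have mn : measurable_fun setT (fun w => (S^\- w)%:E).
  by apply/measurable_EFinP; exact: measurable_funrneg.
have mn' : measurable_fun setT (fun w => (S'^\- w)%:E).
  by apply/measurable_EFinP; exact: measurable_funrneg.
have mp' : measurable_fun setT (fun w => (S'^\+ w)%:E).
  by apply/measurable_EFinP; exact: measurable_funrpos.
move=> step.
have -> : (\int[P]_w (S^\- w)%:E = \int[P]_(w in A) (S^\- w)%:E)%E.
  rewrite [RHS]integral_mkcond; apply: eq_integral => w _.
  rewrite patchE; case: ifPn => // wA; congr EFin.
  apply/max_idPr; rewrite oppr_le0 leNgt; apply/negP => ?.
  by move/negP: wA; apply; rewrite inE.
apply: le_trans (_ : _ <= \int[P]_(w in A) (S'^\- w)%:E)%E _; last first.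
  by apply: ge0_subset_integral => // w _; rewrite lee_fin.
apply: le_trans (le_trans _ step) _.
  apply: ge0_le_integral => //.
  - by move=> w _; rewrite lee_fin.
  - exact: measurable_funTS.
  - under eq_fun do rewrite EFinD.
    by apply: measurable_funTS; exact: emeasurable_funD.
  - by move=> w _; rewrite lee_fin lerDr.
rewrite le_eqVlt; apply/orP; left; apply/eqP; apply: eq_integral => w.
rewrite inE => Aw; congr EFin; rewrite -[RHS]add0r; congr (_ + _).
by apply/max_idPr; exact: ltW.
Qed.

(** Localize to the whole space; both negative parts have finite integrals, so
    they can be moved across the inequality. *)
Lemma le_integral_supermartingale (S S' : Omega -> R) d
    (v N : Omega -> 'rV[R]_d) :
  measurable_wrt G S -> measurable_fun setT S' ->
  (forall i, measurable_wrt G (fun w => v w ord0 i)) ->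
  (forall i, mean_zero (fun w => N w ord0 i)) ->
  (\forall w \ae P, S' w <= S w + dot (v w) (N w)) ->
  (\int[P]_w (S'^\- w)%:E < +oo)%E ->
  (\int[P]_w (S' w)%:E <= \int[P]_w (S w)%:E)%E.
Proof.
move=> mS mS' mv N0 SS' fin'.
have fin := le_lt_trans (le_integral_negpart mS mS' mv N0 SS') fin'.
have mST := measurable_wrt_measurable Gm mS.
have GT_ : G setT by rewrite -setC0 -setTD; case: sG => G0 GD _; exact: GD.
have := supermartingale_step_local mS mS' mv N0 SS' GT_.
have mp (f : Omega -> R) : measurable_fun setT f ->
  measurable_fun setT (fun w => (f^\+ w)%:E).
  by move=> mf; apply/measurable_EFinP; exact: measurable_funrpos.
have mn (f : Omega -> R) : measurable_fun setT f ->
  measurable_fun setT (fun w => (f^\- w)%:E).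
  by move=> mf; apply/measurable_EFinP; exact: measurable_funrneg.
under eq_integral do rewrite EFinD.
rewrite ge0_integralD//; [|by move=> w _; rewrite lee_fin|exact: mp
  |by move=> w _; rewrite lee_fin|exact: mn].
under [X in (_ <= X)%E]eq_integral do rewrite EFinD.
rewrite [X in (_ <= X)%E]ge0_integralD//; [|by move=> w _; rewrite lee_fin|exact: mp
  |by move=> w _; rewrite lee_fin|exact: mn].
have IE (f : Omega -> R) : (\int[P]_w (f w)%:E =
    \int[P]_w (f^\+ w)%:E - \int[P]_w (f^\- w)%:E)%E.
  rewrite integralE; congr (_ - _)%E; apply: eq_integral => w _.
    by rewrite funeposE /funrpos EFin_max.
  by rewrite funenegE /funrneg EFin_max.
rewrite (IE S') (IE S); set a := (\int[P]_w _)%E; set b := (\int[P]_w _)%E.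
set c := (\int[P]_w _)%E; set e := (\int[P]_w _)%E.
have fb : b \is a fin_num.
  by rewrite ge0_fin_numE//; apply: integral_ge0 => w _; rewrite lee_fin.
have fe : e \is a fin_num.
  by rewrite ge0_fin_numE//; apply: integral_ge0 => w _; rewrite lee_fin.
move=> h.
by rewrite leeBrDr// addeAC leeBlDr.
Qed.

End FixedSubAlgebra.

(** An integral is the difference of the integrals of the positive and negative
    parts, and each of these is monotone, even when infinite. *)
Lemma ae_le_integral (f g : Omega -> R) :
  measurable_fun setT f -> measurable_fun setT g ->
  (\forall w \ae P, f w <= g w) ->
  (\int[P]_w (g^\- w)%:E <= \int[P]_w (f^\- w)%:E)%E /\
  (\int[P]_w (f w)%:E <= \int[P]_w (g w)%:E)%E.
Proof.
move=> mf mg fg.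
have neg : (\int[P]_w (g^\- w)%:E <= \int[P]_w (f^\- w)%:E)%E.
  apply: ae_ge0_le_integral => //.
  - by move=> w _; rewrite lee_fin.
  - by apply/measurable_EFinP; exact: measurable_funrneg.
  - by move=> w _; rewrite lee_fin.
  - by apply/measurable_EFinP; exact: measurable_funrneg.
  apply: filterS fg => w fgw _; rewrite lee_fin /funrneg.
  by rewrite ge_max !le_max lerN2 fgw lexx orbT.
have pos : (\int[P]_w (f^\+ w)%:E <= \int[P]_w (g^\+ w)%:E)%E.
  apply: ae_ge0_le_integral => //.
  - by move=> w _; rewrite lee_fin.
  - by apply/measurable_EFinP; exact: measurable_funrpos.
  - by move=> w _; rewrite lee_fin.
  - by apply/measurable_EFinP; exact: measurable_funrpos.
  apply: filterS fg => w fgw _; rewrite lee_fin /funrpos.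
  by rewrite ge_max !le_max fgw lexx orbT.
split => //; rewrite integralE [leRHS]integralE; apply: leeB.
  move: pos; congr (_ <= _)%E; apply: eq_integral => w _;
    by rewrite funeposE /funrpos EFin_max.
move: neg; congr (_ <= _)%E; apply: eq_integral => w _;
  by rewrite funenegE /funrneg EFin_max.
Qed.

End SubSigmaAlgebra.

(** * Scalar products, cones and polars *)

Section Dot.
Context (R : realType) (d : nat).
Implicit Types (x y z : 'rV[R]_d) (A C : set 'rV[R]_d).

Lemma dotC x y : dot x y = dot y x.
Proof. by apply: eq_bigr => i _; rewrite mulrC. Qed.

Lemma dotDl x y z : dot (x + y) z = dot x z + dot y z.
Proof.
by rewrite -big_split/=; apply: eq_bigr => i _; rewrite mxE mulrDl.
Qed.

Lemma dotDr x y z : dot x (y + z) = dot x y + dot x z.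
Proof. by rewrite dotC dotDl !(dotC _ x). Qed.

Lemma dotZl k x y : dot (k *: x) y = k * dot x y.
Proof. by rewrite mulr_sumr; apply: eq_bigr => i _; rewrite mxE mulrA. Qed.

Lemma dotZr k x y : dot x (k *: y) = k * dot x y.
Proof. by rewrite dotC dotZl dotC. Qed.

Lemma dotNl x y : dot (- x) y = - dot x y.
Proof. by rewrite -scaleN1r dotZl mulN1r. Qed.

Lemma dotNr x y : dot x (- y) = - dot x y.
Proof. by rewrite dotC dotNl dotC. Qed.

Lemma dot0r x : dot x 0 = 0.
Proof. by rewrite -(scale0r 0) dotZr mul0r. Qed.

Lemma dot0l x : dot 0 x = 0.
Proof. by rewrite dotC dot0r. Qed.

Lemma dot_sumr I (r : seq I) (Q : pred I) (F : I -> 'rV[R]_d) x :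
  dot x (\sum_(i <- r | Q i) F i) = \sum_(i <- r | Q i) dot x (F i).
Proof. by elim/big_rec2: _ => [|i a b _ <-]; rewrite ?dot0r// dotDr. Qed.

Lemma dot_suml I (r : seq I) (Q : pred I) (F : I -> 'rV[R]_d) x :
  dot (\sum_(i <- r | Q i) F i) x = \sum_(i <- r | Q i) dot (F i) x.
Proof. by rewrite dotC dot_sumr; apply: eq_bigr => i _; rewrite dotC. Qed.

Lemma dotvv_ge0 x : 0 <= dot x x.
Proof. by apply: sumr_ge0 => i _; rewrite -expr2 sqr_ge0. Qed.

Lemma sqr_le_dot x i : x ord0 i ^+ 2 <= dot x x.
Proof.
rewrite /dot (bigD1 i)//= -expr2 lerDl.
by apply: sumr_ge0 => j _; rewrite -expr2 sqr_ge0.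
Qed.

Lemma norm_le_dot x i : `|x ord0 i| <= 1 + dot x x.
Proof.
have := sqr_le_dot x i; rewrite -real_normK ?num_real//.
set y := `|_|; have := sqr_ge0 (y - 1); have : 0 <= y by exact: normr_ge0.
by nra.
Qed.

Lemma dot_le x y : `|dot x y| <= dot x x + dot y y.
Proof.
apply: le_trans (ler_norm_sum _ _ _) _; rewrite -big_split/=.
apply: ler_sum => i _; rewrite normrM.
set a := x _ _; set b := y _ _.
have -> : a * a = `|a| ^+ 2 by rewrite real_normK ?num_real// expr2.
have -> : b * b = `|b| ^+ 2 by rewrite real_normK ?num_real// expr2.
have := sqr_ge0 (`|a| - `|b|); have := normr_ge0 a; have := normr_ge0 b.
by nra.
Qed.

Lemma cone_sub A x : A x -> cone A x.
Proof.
move=> Ax; exists 1%N, (fun=> 1), (fun=> x); split => //.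
by rewrite big_ord1 scale1r.
Qed.

Lemma cone0 A : cone A 0.
Proof.
by exists 0%N, (fun=> 0), (fun=> 0); split => [//|[]//|]; rewrite big_ord0.
Qed.

Lemma coneD A x y : cone A x -> cone A y -> cone A (x + y).
Proof.
move=> [m [l [a [l0 Aa ->]]]] [n [k [b [k0 Ab ->]]]].
exists (m + n)%N.
exists (fun i => match fintype.split i with inl i => l i | inr j => k j end).
exists (fun i => match fintype.split i with inl i => a i | inr j => b j end).
split=> [i|i|].
- by case: fintype.split.
- by case: fintype.split.
rewrite big_split_ord/=; congr (_ + _); apply: eq_bigr => i _.
  by case: splitP => j /= ij; [congr (_ *: _); congr (_ _); exact: val_inj
    |have := ltn_ord i; rewrite ij ltnNge leq_addr].
case: splitP => j /= ij; last first.
  by move/addnI: ij => ij; congr (_ *: _); congr (_ _); exact: val_inj.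
by have := ltn_ord j; rewrite -ij ltnNge leq_addr.
Qed.

Lemma coneZ A (k : R) x : 0 <= k -> cone A x -> cone A (k *: x).
Proof.
move=> k0 [m [l [a [l0 Aa ->]]]]; exists m, (fun i => k * l i), a.
split=> [i|//|]; first exact: mulr_ge0.
by rewrite scaler_sumr; apply: eq_bigr => i _; rewrite scalerA.
Qed.

Lemma polar_cone A y : (forall x, A x -> 0 <= dot x y) -> polar (cone A) y.
Proof.
move=> Ay _ [m [l [a [l0 Aa ->]]]]; rewrite dot_suml sumr_ge0// => i _.
by rewrite dotZl mulr_ge0//; exact: Ay.
Qed.

End Dot.

(** * Integrals of real functions *)

Section Integrals.
Context (disp : measure_display) (Omega : measurableType disp) (R : realType).
Context (P : probability Omega R).

Lemma integrable_fctD (f g : Omega -> R) :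
  P.-integrable setT (EFin \o f) -> P.-integrable setT (EFin \o g) ->
  P.-integrable setT (EFin \o (fun w => f w + g w)).
Proof.
move=> i_f ig; apply: eq_integrable (integrableD measurableT i_f ig) => //.
Qed.

Lemma integrable_fctB (f g : Omega -> R) :
  P.-integrable setT (EFin \o f) -> P.-integrable setT (EFin \o g) ->
  P.-integrable setT (EFin \o (fun w => f w - g w)).
Proof.
move=> i_f ig; apply: eq_integrable (integrableB measurableT i_f ig) => //.
Qed.

Lemma integrable_fctZ (k : R) (f : Omega -> R) :
  P.-integrable setT (EFin \o f) ->
  P.-integrable setT (EFin \o (fun w => k * f w)).
Proof. by move=> i_f; apply: eq_integrable (integrableZl measurableT k i_f). Qed.

Lemma integrable_fct_sum I (r : seq I) (Q : pred I) (f : I -> Omega -> R) :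
  (forall i, Q i -> P.-integrable setT (EFin \o f i)) ->
  P.-integrable setT (EFin \o (fun w => \sum_(i <- r | Q i) f i w)).
Proof.
move=> i_f; apply: eq_integrable
  (@integrable_sum _ _ _ P setT measurableT I r Q (fun i => EFin \o f i) i_f) => //.
by move=> w _; rewrite /= sumEFin.
Qed.

Lemma measurable_fun_inv d' (T' : measurableType d') (f : T' -> R) :
  measurable_fun setT f -> (forall w, f w != 0) ->
  measurable_fun setT (fun w => (f w)^-1).
Proof.
move=> mf f0; apply: (@measurable_comp _ _ _ _ _ _ [set x : R | x != 0]).
- by apply: open_measurable; exact: open_neq.
- by move=> _ [w _ <-]; exact: f0.
- apply: open_continuous_measurable_fun; first exact: open_neq.
  by move=> x; rewrite inE => x0; exact: inv_continuous.
- exact: mf.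
Qed.

Lemma measurable_dot d' (T' : measurableType d') d (X Y : T' -> 'rV[R]_d) :
  (forall i, measurable_fun setT (fun w => X w ord0 i)) ->
  (forall i, measurable_fun setT (fun w => Y w ord0 i)) ->
  measurable_fun setT (fun w => dot (X w) (Y w)).
Proof.
by move=> mX mY; apply: measurable_sum => i; exact: measurable_funM.
Qed.

Lemma condexpP (G : set (set Omega)) (X : Omega -> R) :
  sigma_algebra setT G -> G `<=` measurable ->
  P.-integrable setT (EFin \o X) -> is_condexp P G X (condexp P G X).
Proof.
move=> sG Gm iX; have [Y GY] := condexp_exists sG Gm iX.
rewrite /condexp.
by apply: (@xgetPex _ (cst 0) [set Y | is_condexp P G X Y]); exists Y.
Qed.

(** The event where [f] is below its mean has probability 0 or 1, and it cannot
    have probability 1. *)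
Lemma trivial_integral_le (G : set (set Omega)) (f : Omega -> R) :
  sigma_algebra setT G -> G `<=` measurable -> trivial_sigma_algebra P G ->
  measurable_wrt G f -> P.-integrable setT (EFin \o f) ->
  \forall w \ae P, (\int[P]_w (f w)%:E <= (f w)%:E)%E.
Proof.
move=> sG Gm tG mf i_f.
have mfT := measurable_wrt_measurable Gm mf.
have Ifin : (\int[P]_w (f w)%:E)%E \is a fin_num by exact: integrable_fin_num.
set c := fine (\int[P]_w (f w)%:E)%E.
have cE : (\int[P]_w (f w)%:E)%E = c%:E by rewrite fineK.
have GA : G (f @^-1` [set x | x < c]).
  apply: measurable_wrt_preimage => //.
  by rewrite -set_itvNyo; exact: measurable_itv.
set A := f @^-1` _ in GA; have mA : measurable A by exact: Gm.
have PA : P A = 0%E.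
  have [//|PA1] := tG _ GA; exfalso.
  have PAC : P (~` A) = 0%E by rewrite probability_setC// PA1 subee.
  have pos : \forall w \ae P, 0 < c - f w.
    exists (~` A); split => //; first exact: measurableC.
    by move=> w /= h Aw; apply: h; rewrite subr_gt0.
  have mc : measurable_fun setT (fun w => c - f w) by exact: measurable_funB.
  have : (\int[P]_w `|(c - f w)%:E| = 0)%E.
    transitivity (\int[P]_w (c - f w)%:E)%E.
      apply: ae_eq_integral => //.
      - by apply: measurableT_comp => //; exact/measurable_EFinP.
      - exact/measurable_EFinP.
      by apply: filterS pos => w cw _; rewrite gee0_abs// lee_fin ltW.
    under eq_integral do rewrite EFinB.
    rewrite integralB_EFin//; last exact: finite_measure_integrable_cst.
    rewrite (_ : (\int[P]_w c%:E = c%:E)%E) ?cE ?subee//.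
    rewrite -[LHS]/(\int[P]_w cst c%:E w)%E integral_cst//.
    by rewrite [X in (_ * X)%E]probability_setT mule1.
  have mcE : measurable_fun setT (fun w => (c - f w)%:E) by exact/measurable_EFinP.
  move/(ae_eq_integral_abs P measurableT mcE) => h.
  have : \forall w \ae P, False.
    apply: filterS2 pos h => w cw /(_ I) [] c0.
    by move: cw; rewrite c0 ltxx.
  case=> N [mN PN sN]; have : N = setT by apply/seteqP; split => // w _; exact: sN.
  by move=> NT; move: PN; rewrite NT probability_setT => /eqP; rewrite onee_eq0.
exists A; split => // w /= /negP; rewrite cE lee_fin -ltNge.
by [].
Qed.

End Integrals.

(** * Dual processes bound superhedging prices *)

Section Duality.
Context (disp : measure_display) (Omega : measurableType disp) (R : realType).
Context (P : probability Omega R) (T d : nat).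
Context (F : 'I_T.+1 -> set (set Omega)) (filtration_F : filtration F).
Implicit Types (K : set_process Omega R T d) (Z V xi theta : process Omega R T d).

Let sF t : sigma_algebra setT (F t). Proof. by case: filtration_F. Qed.
Let Fm t : F t `<=` measurable. Proof. by case: filtration_F. Qed.
Let Fmono (s t : 'I_T.+1) : (s <= t)%N -> F s `<=` F t.
Proof. by case: filtration_F => _ _; exact. Qed.

Lemma wealth_adapted x xi :
  L0_process P F (cst setT) xi -> L0_process P F (cst setT) (wealth x xi).
Proof.
move=> axi t; split; last exact: aeW.
move=> i; have -> : (fun w => wealth x xi t w ord0 i) =
    (fun w => x ord0 i + \sum_(s < T.+1) if (s <= t)%N then xi s w ord0 i else 0).
  by apply/funext => w; rewrite /wealth mxE summxE -big_mkcond.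
apply: measurable_funD; first exact: measurable_cst.
apply: measurable_sum => s; have [st|_] := leqP s t; last exact: measurable_cst.
by apply: measurable_wrt_sub (Fmono st) _; case: (axi s).
Qed.

Section Dual.
Context (Z : process Omega R T d).
Hypothesis iZ : forall t i, P.-integrable setT (EFin \o (fun w => Z t w ord0 i)).

Let tail (n : nat) (w : Omega) : 'rV[R]_d := \sum_(s < T.+1 | (n <= s)%N) Z s w.

Let integrable_tail n i : P.-integrable setT (EFin \o (fun w => tail n w ord0 i)).
Proof.
have -> : EFin \o (fun w => tail n w ord0 i) =
    (fun w => \sum_(s < T.+1 | (n <= s)%N) (Z s w ord0 i)%:E)%E.
  by apply/funext => w; rewrite /= summxE sumEFin.
by apply: integrable_sum => // s _; exact: iZ.
Qed.

Lemma Zbar_condexp t i :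
  is_condexp P (F t) (fun w => (\sum_(s < T.+1 | (t <= s)%N) Z s w) ord0 i)
    (fun w => Zbar P F Z t w ord0 i).
Proof.
have -> : (fun w => Zbar P F Z t w ord0 i) =
    condexp P (F t) (fun w => (\sum_(s < T.+1 | (t <= s)%N) Z s w) ord0 i).
  by apply/funext => w; rewrite /Zbar /condexp_vec mxE.
by apply: condexpP => //; exact: integrable_tail.
Qed.

(** Bounded [F t]-measurable positions can be valued with [Zbar] instead of with
    the tail sum of [Z]. *)
Lemma integral_dot_Zbar t (xi : Omega -> 'rV[R]_d) (M : R) :
  (forall i, measurable_wrt (F t) (fun w => xi w ord0 i)) ->
  (forall w i, `|xi w ord0 i| <= M) -> 0 <= M ->
  P.-integrable setT (EFin \o (fun w => dot (xi w) (Zbar P F Z t w))) /\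
  (\int[P]_w (dot (xi w) (Zbar P F Z t w))%:E =
   \int[P]_w (dot (xi w) (\sum_(s < T.+1 | (t <= s)%N) Z s w))%:E)%E.
Proof.
move=> mxi xiM M0.
have iZb i : P.-integrable setT (EFin \o (fun w => Zbar P F Z t w ord0 i)).
  by case: (Zbar_condexp t i).
have i1 : P.-integrable setT (EFin \o (fun w => dot (xi w) (Zbar P F Z t w))).
  apply: integrable_fct_sum => i _; apply: (integrable_boundedM (M := M)) => //.
  exact: (measurable_wrt_measurable (@Fm t) (mxi i)).
split => //.
pose N w := tail t w - Zbar P F Z t w.
have N0 i : mean_zero P (F t) (fun w => N w ord0 i).
  rewrite /N; under eq_fun do rewrite 2!mxE; split.
    by apply: integrable_fctB => //; exact: integrable_tail.
  move=> A FA; have mA : measurable A by exact: Fm FA.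
  have iA (f : Omega -> R) : P.-integrable setT (EFin \o f) ->
      P.-integrable A (EFin \o f) by move=> i_f; exact: integrableS i_f.
  under eq_integral do rewrite EFinB.
  rewrite integralB_EFin//; [|by apply: iA; exact: integrable_tail|exact: iA].
  have [_ _ ->//] := Zbar_condexp t i.
  by rewrite subee// integrable_fin_num//; apply: iA; exact: integrable_tail.
have FT : F t setT by case: (sF t) => F0 FC _; rewrite -setC0 -setTD; exact: FC.
have [iN IN] :=
  mean_zero_local_dot (sF t) (@Fm t) mxi N0 FT (fun w i _ => xiM w i) M0.
rewrite -[LHS]add0e -IN -integralD//.
apply: eq_integral => w _; rewrite -EFinD -dotDr; congr (dot _ _)%:E.
by rewrite /N subrK.
Qed.

(** [Zbar], with the value 0 after the horizon, so that the last step of the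
    backward recursion has the same form as the others. *)
Let Y (n : nat) (w : Omega) : 'rV[R]_d :=
  if (n <= T)%N then Zbar P F Z (inord n) w else 0.

Let integrable_Y n i : P.-integrable setT (EFin \o (fun w => Y n w ord0 i)).
Proof.
rewrite /Y; have [nT|nT] := leqP n T; first by case: (Zbar_condexp (inord n) i).
under eq_fun do rewrite mxE; exact: integrable0.
Qed.

Let integral_Y n i A : ((n <= T)%N -> F (inord n) A) ->
  (\int[P]_(w in A) (Y n w ord0 i)%:E = \int[P]_(w in A) (tail n w ord0 i)%:E)%E.
Proof.
move=> FA; rewrite /Y; have [nT|nT] := leqP n T.
  have [_ _ ->] := Zbar_condexp (inord n) i; last exact: FA.
  by rewrite /tail inordK.
apply: eq_integral => w _; rewrite /tail big1// => s.
by move=> ns; have := ltn_ord s; rewrite ltnS leqNgt (leq_trans nT ns).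
Qed.

(** The tail sums of [Z] starting at [n] and at [n.+1] differ by [Z n]; their
    integrals over an event of [F n] are those of [Zbar]. *)
Lemma mean_zero_increment n i : (n <= T)%N ->
  mean_zero P (F (inord n))
    (fun w => (Z (inord n) w + Y n.+1 w - Y n w) ord0 i).
Proof.
move=> nT; have tn : (inord n : 'I_T.+1) = n :> nat by rewrite inordK.
have E : (fun w => (Z (inord n) w + Y n.+1 w - Y n w) ord0 i) =
    (fun w => Z (inord n) w ord0 i + Y n.+1 w ord0 i - Y n w ord0 i).
  by apply/funext => w; rewrite !mxE.
have iS : P.-integrable setT
    (EFin \o (fun w => Z (inord n) w ord0 i + Y n.+1 w ord0 i)).
  by apply: integrable_fctD; [exact: iZ|exact: integrable_Y].
rewrite E; split.
  by apply: integrable_fctB => //; exact: integrable_Y.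
move=> A FA; have mA : measurable A by exact: Fm FA.
have iA (f : Omega -> R) : P.-integrable setT (EFin \o f) ->
    P.-integrable A (EFin \o f) by move=> i_f; exact: integrableS i_f.
under eq_integral do rewrite EFinB.
rewrite integralB_EFin//; [|exact: iA|by apply: iA; exact: integrable_Y].
under eq_integral do rewrite EFinD.
rewrite integralD//; [|by apply: iA; exact: iZ|by apply: iA; exact: integrable_Y].
rewrite integral_Y; last first.
  by move=> nT'; apply: Fmono FA; rewrite !inordK.
rewrite integral_Y//.
have tailE w : tail n w = Z (inord n) w + tail n.+1 w.
  rewrite /tail (bigD1 (inord n)) ?tn//=; congr (_ + _); apply: eq_bigl => s.
  by rewrite -(inj_eq val_inj)/= tn [RHS]ltn_neqAle andbC eq_sym.
under [X in (_ - X)%E]eq_integral do rewrite tailE mxE EFinD.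
rewrite [X in (_ - X)%E]integralD//;
  [|by apply: iA; exact: iZ|by apply: iA; exact: integrable_tail].
rewrite subee// fin_numD; apply/andP; split; apply: integrable_fin_num => //.
  by apply: iA; exact: iZ.
by apply: iA; exact: integrable_tail.
Qed.

Lemma wealth_step x xi (n : nat) w : (n < T)%N ->
  wealth x xi (inord n.+1) w = wealth x xi (inord n) w + xi (inord n.+1) w.
Proof.
move=> nT; rewrite /wealth -addrA; congr (_ + _).
have tn : (inord n : 'I_T.+1) = n :> nat by rewrite inordK// ltnW.
have tn1 : (inord n.+1 : 'I_T.+1) = n.+1 :> nat by rewrite inordK.
rewrite (bigD1 (inord n.+1)) ?leqnn//= addrC; congr (_ + _); apply: eq_bigl => s.
by rewrite -(inj_eq val_inj)/= tn tn1 andbC -ltn_neqAle ltnS.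
Qed.

(** The process [S] of the opening comment, indexed by natural numbers up to
    [T.+1]: its value at [T.+1] dominates the sum of the [dot theta Z], and the
    one-step inequalities are chained backwards from there. *)
Lemma superhedge_integral_le K x xi theta :
  (forall t i, measurable_wrt (F t) (fun w => Z t w ord0 i)) ->
  (forall t, \forall w \ae P, polar (K t w) (Z t w)) ->
  (forall t, \forall w \ae P, polar (K t w) (Zbar P F Z t w)) ->
  L0_process P F (cst setT) xi -> (forall t, \forall w \ae P, K t w (- xi t w)) ->
  L0_process P F (cst setT) theta ->
  (forall t, \forall w \ae P, K t w (wealth x xi t w - theta t w)) ->
  (forall t, P.-integrable setT
     (EFin \o (fun w => dot (Z t w) (theta t w))^\-)) ->
  (\int[P]_w (\sum_(t < T.+1) dot (theta t w) (Z t w))%:E <=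
   \int[P]_w (dot x (Zbar P F Z ord0 w))%:E)%E.
Proof.
move=> mZ pZ pZb axi Kxi ath KV ineg.
(* The body of V is hidden, otherwise the rewriting rules for dot expand it. *)
have [V VE] : exists V, V = wealth x xi by eexists.
have aV : L0_process P F (cst setT) V by rewrite VE; exact: wealth_adapted.
rewrite -VE in KV.
have mV t i : measurable_wrt (F t) (fun w => V t w ord0 i) by case: (aV t).
have mth t i : measurable_wrt (F t) (fun w => theta t w ord0 i).
  by case: (ath t).
have up t f : measurable_wrt (F t) f -> measurable_fun setT f.
  exact: measurable_wrt_measurable.
have mY n i : measurable_wrt (F (inord n)) (fun w => Y n w ord0 i).
  rewrite /Y; have [nT|nT] := leqP n T.
    by case: (Zbar_condexp (inord n) i).
  under eq_fun do rewrite mxE; exact: measurable_cst.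
pose S n w : R := \sum_(u < T.+1 | (u < n)%N) dot (Z u w) (V u w) +
  dot (V (inord n) w) (Y n w).
have mS n : (n <= T)%N -> measurable_wrt (F (inord n)) (S n).
  move=> nT; apply: measurable_funD; last first.
    by apply: measurable_dot; [exact: mV|exact: mY].
  under eq_fun do rewrite big_mkcond.
  apply: measurable_sum => u; have [un|_] := leqP u.+1 n; last first.
    exact: measurable_cst.
  apply: (measurable_wrt_sub (G := F u)).
    by apply: Fmono; rewrite inordK// ltnW.
  by apply: measurable_dot; [exact: mZ|exact: mV].
have mST n : measurable_fun setT (S n).
  apply: measurable_funD; last first.
    by apply: measurable_dot => i; apply: up; [exact: mV|exact: mY].
  under eq_fun do rewrite big_mkcond.
  apply: measurable_sum => u; have [un|_] := leqP u.+1 n => //.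
  by apply: measurable_dot => i; apply: up; [exact: mZ|exact: mV].
have step n : (n <= T)%N -> \forall w \ae P, S n.+1 w <=
    S n w + dot (V (inord n) w) (Z (inord n) w + Y n.+1 w - Y n w).
  move=> nT.
  have tn : (inord n : 'I_T.+1) = n :> nat by rewrite inordK.
  have SE w : \sum_(u < T.+1 | (u < n.+1)%N) dot (Z u w) (V u w) =
      \sum_(u < T.+1 | (u < n)%N) dot (Z u w) (V u w) +
      dot (Z (inord n) w) (V (inord n) w).
    rewrite (bigD1 (inord n)) ?tn//= addrC; congr (_ + _); apply: eq_bigl => s.
    by rewrite -(inj_eq val_inj)/= tn ltnS andbC -ltn_neqAle.
  have [nT'|Tn] := ltnP n T; last first.
    have Y0 w : Y n.+1 w = 0 by rewrite /Y ltnNge Tn.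
    apply: aeW => w; rewrite /S SE Y0 addr0 !dotDr dotNr dot0r.
    by rewrite (dotC (Z (inord n) w)); lra.
  have t1 : (inord n.+1 : 'I_T.+1) = n.+1 :> nat by rewrite inordK.
  apply: filterS2 (pZb (inord n.+1)) (Kxi (inord n.+1)) => w pw kw.
  rewrite /S SE !dotDr dotNr (dotC (Z (inord n) w)) VE wealth_step// -VE dotDl.
  have : dot (xi (inord n.+1) w) (Y n.+1 w) <= 0.
    by rewrite /Y nT' -oppr_ge0 -dotNl; exact: pw.
  by lra.
have ST : \forall w \ae P, \sum_(t < T.+1) dot (theta t w) (Z t w) <= S T.+1 w.
  have : \forall w \ae P, forall t : 'I_T.+1,
      dot (theta t w) (Z t w) <= dot (Z t w) (V t w).
    apply: filter_forall => t; apply: filterS2 (pZ t) (KV t) => w pw kw.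
    have := pw _ kw; rewrite dotDl dotNl (dotC _ (Z t w)) subr_ge0.
    by rewrite dotC.
  apply: filterS => w h; rewrite /S /Y ltnn dot0r addr0.
  rewrite [leRHS](eq_bigl xpredT); first by apply: ler_sum => t _; exact: h.
  by move=> u; exact: ltn_ord.
have S0 : \forall w \ae P, S 0 w <= dot x (Zbar P F Z ord0 w).
  have i0 : inord 0 = ord0 :> 'I_T.+1 by apply: val_inj; rewrite /= inordK.
  apply: filterS2 (pZb ord0) (Kxi ord0) => w pw kw.
  rewrite /S big_pred0// add0r /Y leq0n i0 VE /wealth (big_pred1 ord0); last first.
    by move=> s; rewrite leqn0.
  rewrite dotDl -[leRHS]addr0 lerD2l -oppr_ge0 -dotNl; exact: pw.
have mtZ t : measurable_fun setT (fun w => dot (theta t w) (Z t w)).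
  by apply: measurable_dot => i; apply: up; [exact: mth|exact: mZ].
have [negT leT] := ae_le_integral (measurable_sum _ mtZ) (mST T.+1) ST.
have fin_neg : (\int[P]_w ((fun w => \sum_(t < T.+1)
    dot (theta t w) (Z t w))^\- w)%:E < +oo)%E.
  apply: (@le_lt_trans _ _ (\int[P]_w (\sum_(t < T.+1)
     (fun w' => dot (Z t w') (theta t w'))^\- w)%:E)%E); last first.
    apply: integrable_lty => //.
    apply: (@integrable_fct_sum _ _ _ P _ (index_enum 'I_T.+1) xpredT
      (fun t => (fun w => dot (Z t w) (theta t w))^\-)).
    by move=> t _; exact: ineg.
  apply: ge0_le_integral => //.
  - by move=> w _; rewrite lee_fin.
  - by apply/measurable_EFinP/measurable_funrneg/measurable_sum.
  - apply/measurable_EFinP/measurable_sum => t; apply: measurable_funrneg.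
    by apply: measurable_dot => i; apply: up; [exact: mZ|exact: mth].
  - move=> w _; rewrite lee_fin /funrneg ge_max sumr_ge0 ?andbT; last first.
      by move=> t _; rewrite le_max lexx orbT.
    rewrite -sumrN; apply: ler_sum => t _.
    by rewrite le_max dotC lexx.
have back k : (k <= T.+1)%N ->
    (\int[P]_w ((S (T.+1 - k)%N)^\- w)%:E < +oo)%E /\
    (\int[P]_w (S T.+1 w)%:E <= \int[P]_w (S (T.+1 - k)%N w)%:E)%E.
  elim: k => [_|k IH kT].
    by rewrite subn0; split => //; exact: le_lt_trans negT fin_neg.
  have [fk lek] := IH (ltnW kT).
  set n := (T.+1 - k.+1)%N; have nT : (n <= T)%N by rewrite /n subSS leq_subr.
  have nE : (T.+1 - k)%N = n.+1 by rewrite /n subnSK.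
  rewrite nE in fk lek.
  have mN := fun i => @mean_zero_increment n i nT.
  have neg := le_integral_negpart (sF _) (@Fm _) (mS n nT) (mST n.+1) (mV _) mN
    (step n nT).
  split; first exact: le_lt_trans neg fk.
  apply: le_trans lek _.
  have := le_integral_supermartingale (sF _) (@Fm _) (mS n nT) (mST n.+1) (mV _)
    mN (step n nT) fk.
  exact.
have [_] := back _ (leqnn _); rewrite subnn => le0.
apply: le_trans leT _; apply: le_trans le0 _.
have [] := ae_le_integral (mST 0%N) _ S0 => //.
apply: measurable_dot => i; first exact: measurable_cst.
by have [mz _ _] := Zbar_condexp ord0 i; exact: up mz.
Qed.

End Dual.
End Duality.

(** * Projection on a convex cone *)

Section ConeProjection.
Context (R : realType) (V : lmodType R) (L C : set V) (b : V -> V -> R) (a : V).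
Hypothesis LD : forall u v, L u -> L v -> L (u + v).
Hypothesis LZ : forall k u, L u -> L (k *: u).
Hypothesis bC : forall u v, b u v = b v u.
Hypothesis bD : forall u v w, L u -> L v -> L w -> b (u + v) w = b u w + b v w.
Hypothesis bZ : forall k u w, L u -> L w -> b (k *: u) w = k * b u w.
Hypothesis b_ge0 : forall u, 0 <= b u u.
Hypothesis La : L a.
Hypothesis CL : C `<=` L.
Hypothesis C0 : C 0.
Hypothesis CD : forall u v, C u -> C v -> C (u + v).
Hypothesis CZ : forall k u, 0 <= k -> C u -> C (k *: u).
Hypothesis complete : forall (c : nat -> V) (delta : R),
  (forall n, C (c n)) ->
  (forall n, b (a - c n) (a - c n) <= delta + 8^-1 ^+ n) ->
  (forall n, b (c n.+1 - c n) (c n.+1 - c n) <= 4 * 8^-1 ^+ n) ->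
  exists2 p, C p & b (a - p) (a - p) <= delta.

Let q_line u v k : L u -> L v ->
  b (u + k *: v) (u + k *: v) = b u u + 2 * k * b u v + k ^+ 2 * b v v.
Proof.
move=> Lu Lv; have Lkv := LZ k Lv; have Luv := LD Lu Lkv.
rewrite bD// (bC u) (bC (k *: v)) !bD// (bC u (k *: v)) !bZ//.
by rewrite (bC v (k *: v)) bZ// (bC v u); ring.
Qed.

(** A minimizing sequence in [C] is fast Cauchy by the parallelogram identity,
    because midpoints stay in [C]; completeness yields a closest point [p].
    Moving [p] in the direction of an element of [C], or shrinking [p] itself,
    cannot decrease the distance to [a], which gives the two sign conditions. *)
Lemma cone_projection :
  exists2 p, C p & (forall c, C c -> b (a - p) c <= 0) /\ b (a - p) p = 0.
Proof.
pose D := [set b (a - c) (a - c) | c in C].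
have D0 : D !=set0 by exists (b (a - 0) (a - 0)); exists 0.
have lD : has_lbound D by exists 0 => _ [c _ <-]; exact: b_ge0.
have Lac c : C c -> L (a - c).
  by move=> /CL Lc; apply: LD => //; rewrite -scaleN1r; exact: LZ.
pose delta := inf D.
have dle c : C c -> delta <= b (a - c) (a - c).
  by move=> Cc; apply: ge_inf => //; exists c.
have cn n : exists c, C c /\ b (a - c) (a - c) <= delta + 8^-1 ^+ n.
  have e0 : 0 < 8^-1 ^+ n :> R by rewrite exprn_gt0// invr_gt0.
  have [_ [c Cc <-] lt] := inf_adherent e0 (conj D0 lD).
  by exists c; split => //; exact: ltW.
have [c cP] := choice cn.
have [|n|n|p Cp pd] := complete (c := c) (delta := delta).
- by move=> n; case: (cP n).
- by case: (cP n).
- have [C1 l1] := cP n; have [C2 l2] := cP n.+1.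
  set u := a - c n; set v := a - c n.+1.
  have Lu : L u by exact: Lac.
  have Lv : L v by exact: Lac.
  have -> : c n.+1 - c n = u + (-1) *: v.
    by rewrite scaleN1r /u /v opprB [a - c n]addrC addrCA addrK.
  rewrite q_line//.
  have := dle (2^-1 *: (c n + c n.+1)) (CZ _ (CD C1 C2)).
  have -> : a - 2^-1 *: (c n + c n.+1) = 2^-1 *: (u + 1 *: v).
    rewrite scale1r /u /v addrACA -opprD scalerBr; congr (_ - _).
    rewrite scalerDr -scalerDl.
    by rewrite (_ : 2^-1 + 2^-1 = 1 :> R) ?scale1r//; lra.
  rewrite invr_ge0 ler0n => /(_ isT).
  rewrite bZ//; [|by apply: LD => //; exact: LZ|by apply/LZ/LD => //; exact: LZ].
  rewrite bC bZ//; [|by apply: LD => //; exact: LZ|by apply: LD => //; exact: LZ].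
  rewrite q_line//; move: l1 l2; rewrite -/u -/v exprS.
  have e0 : 0 < 8^-1 ^+ n :> R by rewrite exprn_gt0// invr_gt0.
  by move: e0; set e := _ ^+ n; lra.
exists p => //.
have Lp := CL Cp; have Lr := Lac _ Cp; set r := a - p in pd Lr *.
have qr : b r r = delta by apply/eqP; rewrite eq_le pd/=; exact: dle.
have vary k x : L x -> C (p - k *: x) -> 0 <= 2 * k * b r x + k ^+ 2 * b x x.
  move=> Lx Cx; have := dle _ Cx; rewrite opprB addrA addrAC -/r.
  by rewrite q_line// qr; lra.
have up c' : C c' -> b r c' <= 0.
  move=> Cc; rewrite leNgt; apply/negP => beta0.
  have gamma0 := b_ge0 c'; set be := b r c' in beta0; set ga := b c' c' in gamma0.
  have ga1 : 0 < ga + 1 by lra.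
  (* The step that makes the linear decrease beat the quadratic increase. *)
  pose t := be / (ga + 1); have t0 : 0 < t by rewrite divr_gt0.
  have tE : t * (ga + 1) = be by rewrite /t divfK// gt_eqF.
  have := @vary (- t) c' (CL Cc).
  rewrite scaleNr opprK => /(_ (CD Cp (CZ (ltW t0) Cc))).
  rewrite -/be -/ga; nra.
split; first exact: up.
apply/eqP; rewrite eq_le up//= leNgt; apply/negP => beta0.
have gamma0 := b_ge0 p; set be := b r p in beta0; set ga := b p p in gamma0.
have den : 0 < ga + 1 - be by lra.
pose t := - be / (ga + 1 - be); have t0 : 0 < t by rewrite divr_gt0// oppr_gt0.
have tE : t * (ga + 1 - be) = - be by rewrite /t divfK// gt_eqF.
have t1 : t <= 1 by rewrite ler_pdivrMr//; lra.
have := @vary t p Lp; rewrite -{1}[p]scale1r -scalerBl => /(_ (CZ _ Cp)).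
rewrite subr_ge0 => /(_ t1); rewrite -/be -/ga; nra.
Qed.

End ConeProjection.

(** * A weighted square-integrable space of processes *)

Section WeightedL2.
Context (disp : measure_display) (Omega : measurableType disp) (R : realType).
Context (P : probability Omega R) (T d : nat) (rho : 'I_T.+1 -> Omega -> R).
Hypothesis mrho : forall t, measurable_fun setT (rho t).
Hypothesis rho_gt0 : forall t w, 0 < rho t w.
Implicit Types f g : process Omega R T d.

(** Each date has its own weight, so that the weights can be chosen adapted. *)
Definition weighted_dot f g (w : Omega) : R :=
  \sum_(t < T.+1) rho t w * dot (f t w) (g t w).

Definition weighted_L2 : set (process Omega R T d) :=
  [set f : process Omega R T d |
     (forall t i, measurable_fun setT (fun w => f t w ord0 i)) /\
     P.-integrable setT (EFin \o weighted_dot f f)].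

Definition weighted_inner f g : R := (\int[P]_w weighted_dot f g w)%R.

Lemma weighted_dot_ge0 f w : 0 <= weighted_dot f f w.
Proof.
by apply: sumr_ge0 => t _; rewrite mulr_ge0 ?dotvv_ge0// ltW.
Qed.

Lemma weighted_dotC f g : weighted_dot f g = weighted_dot g f.
Proof. by apply/funext => w; apply: eq_bigr => t _; rewrite dotC. Qed.

Lemma weighted_dotDl f g h w :
  weighted_dot (f + g) h w = weighted_dot f h w + weighted_dot g h w.
Proof.
rewrite -big_split/=; apply: eq_bigr => t _.
by rewrite -mulrDr; congr (_ * _); exact: dotDl.
Qed.

Lemma weighted_dotZl k f h w :
  weighted_dot (k *: f) h w = k * weighted_dot f h w.
Proof.
rewrite mulr_sumr; apply: eq_bigr => t _; rewrite mulrCA.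
by congr (_ * _); exact: dotZl.
Qed.

Lemma measurable_weighted_dot f g :
  (forall t i, measurable_fun setT (fun w => f t w ord0 i)) ->
  (forall t i, measurable_fun setT (fun w => g t w ord0 i)) ->
  measurable_fun setT (weighted_dot f g).
Proof.
move=> mf mg; apply: measurable_sum => t; apply: measurable_funM => //.
exact: measurable_dot.
Qed.

Lemma weighted_dot_le f g w :
  `|weighted_dot f g w| <= weighted_dot f f w + weighted_dot g g w.
Proof.
apply: le_trans (ler_norm_sum _ _ _) _; rewrite -big_split/=.
apply: ler_sum => t _; rewrite normrM -mulrDr gtr0_norm//.
by rewrite ler_wpM2l ?dot_le// ltW.
Qed.

Lemma integrable_weighted_dot f g : weighted_L2 f -> weighted_L2 g ->
  P.-integrable setT (EFin \o weighted_dot f g).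
Proof.
move=> [mf i_f] [mg ig].
apply: (le_integrable measurableT _ _ (integrable_fctD i_f ig)).
  by apply/measurable_EFinP; exact: measurable_weighted_dot.
move=> w _ /=; rewrite lee_fin [leRHS]ger0_norm.
  exact: weighted_dot_le.
by rewrite addr_ge0// weighted_dot_ge0.
Qed.

Lemma weighted_L2D f g :
  weighted_L2 f -> weighted_L2 g -> weighted_L2 (f + g).
Proof.
move=> Lf Lg; have [mf i_f] := Lf; have [mg ig] := Lg.
have mfg t i : measurable_fun setT (fun w => (f + g) t w ord0 i).
  have -> : (fun w => (f + g) t w ord0 i) = (fun w => f t w ord0 i + g t w ord0 i).
    by apply/funext => w; exact: mxE.
  exact: measurable_funD.
split => //.
have ifg := integrable_weighted_dot Lf Lg.
have -> : weighted_dot (f + g) (f + g) = (fun w =>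
    (weighted_dot f f w + weighted_dot f g w) +
    (weighted_dot f g w + weighted_dot g g w)).
  apply/funext => w; rewrite weighted_dotDl.
  by rewrite (weighted_dotC f) (weighted_dotC g) !weighted_dotDl (weighted_dotC g f).
by apply: integrable_fctD; exact: integrable_fctD.
Qed.

Lemma weighted_L2Z k f : weighted_L2 f -> weighted_L2 (k *: f).
Proof.
move=> [mf i_f]; split.
  move=> t i; have -> : (fun w => (k *: f) t w ord0 i) = (fun w => k * f t w ord0 i).
    by apply/funext => w; exact: mxE.
  by apply: measurable_funM => //; exact: measurable_cst.
have -> : weighted_dot (k *: f) (k *: f) =
    (fun w => k * (k * weighted_dot f f w)).
  by apply/funext => w; rewrite weighted_dotZl weighted_dotC weighted_dotZl.
by do 2 apply: integrable_fctZ.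
Qed.

Lemma weighted_innerC f g : weighted_inner f g = weighted_inner g f.
Proof. by rewrite /weighted_inner weighted_dotC. Qed.

Lemma weighted_innerDl f g h : weighted_L2 f -> weighted_L2 g ->
  weighted_L2 h ->
  weighted_inner (f + g) h = weighted_inner f h + weighted_inner g h.
Proof.
move=> Lf Lg Lh; rewrite -RintegralD//; [|exact: integrable_weighted_dot..].
by apply: eq_Rintegral => w _; exact: weighted_dotDl.
Qed.

Lemma weighted_innerZl k f h : weighted_L2 f -> weighted_L2 h ->
  weighted_inner (k *: f) h = k * weighted_inner f h.
Proof.
move=> Lf Lh; rewrite -RintegralZl//; last exact: integrable_weighted_dot.
by apply: eq_Rintegral => w _; exact: weighted_dotZl.
Qed.

Lemma weighted_inner_ge0 f : 0 <= weighted_inner f f.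
Proof. by apply: Rintegral_ge0 => w _; exact: weighted_dot_ge0. Qed.

Lemma weighted_innerE f : weighted_L2 f ->
  (\int[P]_w (weighted_dot f f w)%:E = (weighted_inner f f)%:E)%E.
Proof.
by move=> [_ i_f]; rewrite /weighted_inner /Rintegral fineK// integrable_fin_num.
Qed.

Lemma geometric_increments_cvg (u : nat -> R) (c : R) :
  (forall n, `|u n.+1 - u n| <= c * 2^-1 ^+ n) -> cvgn u.
Proof.
move=> uc.
have half : `|2^-1 : R| < 1 by rewrite ger0_norm ?invr_ge0 ?invf_lt1 ?ltr1n ?ler0n.
have c0 : 0 <= c by have := le_trans (normr_ge0 _) (uc 0%N); rewrite expr0 mulr1.
have cv : cvgn (series (telescope u)).
  apply: (@normed_cvg R R); apply: series_le_cvg (is_cvg_geometric_series (a := c) half).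
  - by move=> n; exact: normr_ge0.
  - by move=> n; rewrite geometric_ge0// invr_ge0.
  - by move=> n; exact: uc.
rewrite (_ : u = (fun n => u 0%N + series (telescope u) n)); last first.
  by apply/funext => n; exact: eq_sum_telescope.
by apply: is_cvgD => //; exact: is_cvg_cst.
Qed.

Lemma weighted_L2B f g :
  weighted_L2 f -> weighted_L2 g -> weighted_L2 (f - g).
Proof.
by move=> Lf Lg; apply: weighted_L2D => //; rewrite -scaleN1r; exact: weighted_L2Z.
Qed.

Lemma sqr_le_weighted_dot f t i w :
  rho t w * f t w ord0 i ^+ 2 <= weighted_dot f f w.
Proof.
rewrite /weighted_dot (bigD1 t)//= ler_wpDr//.
  by apply: sumr_ge0 => s _; rewrite mulr_ge0 ?dotvv_ge0// ltW.
by rewrite ler_wpM2l ?sqr_le_dot// ltW.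
Qed.

(** With [D n] the successive differences, the series of the [4 ^+ n |D n|^2] has
    a finite integral, hence finite sums almost everywhere; at such a point the
    coordinates of [D n] decrease like [2 ^- n], as the weights are positive. *)
Lemma fast_cauchy_ae_cvg (f : nat -> process Omega R T d) :
  (forall n, weighted_L2 (f n)) ->
  (forall n, weighted_inner (f n.+1 - f n) (f n.+1 - f n) <= 4 * 8^-1 ^+ n) ->
  \forall w \ae P, forall t i, cvgn (fun n => f n t w ord0 i).
Proof.
move=> Lf fc.
pose D n : process Omega R T d := f n.+1 - f n.
have LD n : weighted_L2 (D n) by exact: weighted_L2B.
pose a n w := (4 ^+ n * weighted_dot (D n) (D n) w)%:E.
have a0 n w : (0 <= a n w)%E.
  by rewrite lee_fin mulr_ge0 ?exprn_ge0// weighted_dot_ge0.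
have ma n : measurable_fun setT (a n).
  apply/measurable_EFinP; apply: measurable_funM => //.
  by have [mD _] := LD n; exact: measurable_weighted_dot.
have int_a n : (\int[P]_w a n w <= (4 * 2^-1 ^+ n)%:E)%E.
  have [_ iD] := LD n.
  under eq_integral do rewrite /a EFinM.
  rewrite integralZl// weighted_innerE// -EFinM lee_fin.
  apply: le_trans (ler_wpM2l _ (fc n)) _; first by rewrite exprn_ge0.
  rewrite mulrCA -exprMn_comm; last exact: mulrC.
  by rewrite (_ : 4 * 8^-1 = 2^-1 :> R)//; lra.
have isum : P.-integrable setT (fun w => \sum_(0 <= n <oo) a n w)%E.
  apply/integrableP; split.
    exact: (@ge0_emeasurable_sum _ _ _ setT a xpredT).
  under eq_integral do rewrite gee0_abs ?nneseries_ge0//.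
  rewrite integral_nneseries//.
  apply: le_lt_trans (_ : (_ <= \sum_(0 <= n <oo) (8 / (2 ^ (n + 1))%:R)%:E)%E) _.
    apply: lee_nneseries => [n _ _|n _].
      by apply: integral_ge0 => w _.
    apply: le_trans (int_a n) _; rewrite lee_fin exprVn natrX addn1 exprS.
    by rewrite invfM mulrA (_ : 8 / 2 = 4 :> R)//; lra.
  by rewrite (cvg_lim _ (@cvg_geometric_eseries_half R 8 0)) ?ltry.
apply: filterS (integrable_ae measurableT isum) => w /(_ I) wfin t i.
set C := fine (\sum_(0 <= n <oo) a n w)%E.
have aC n : 4 ^+ n * weighted_dot (D n) (D n) w <= C.
  rewrite -lee_fin /C fineK//.
  apply: le_trans (nneseries_lim_ge (m := 0) n.+1 _) => [|? _ _]//.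
  rewrite big_nat_recr//= leeDr// sume_ge0//.
apply: (@geometric_increments_cvg _ (Num.sqrt (C / rho t w))) => n.
have r0 := rho_gt0 t w.
have C0 : 0 <= C by rewrite fine_ge0// nneseries_ge0.
have sE : 2^-1 ^+ n = Num.sqrt (4^-1 ^+ n) :> R.
  have -> : 4^-1 = 2^-1 ^+ 2 :> R by rewrite exprVn; congr (_^-1); ring.
  by rewrite -exprM mulnC exprM sqrtr_sqr ger0_norm// exprn_ge0 ?invr_ge0.
rewrite sE -sqrtrM; last by rewrite divr_ge0// ltW.
apply: (@le_trans _ _ (Num.sqrt ((f n.+1 t w ord0 i - f n t w ord0 i) ^+ 2))).
  by rewrite sqrtr_sqr.
apply: ler_wsqrtr.

have := le_trans (ler_wpM2l _ (sqr_le_weighted_dot (D n) t i w)) (aC n).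
have -> : D n t w ord0 i = f n.+1 t w ord0 i - f n t w ord0 i.
  by rewrite /D !mxE.
move=> /(_ (exprn_ge0 _ (ler0n _ 4))).
rewrite exprVn mulrAC ler_pdivlMr// ler_pdivlMr ?exprn_gt0//.
by rewrite mulrC (mulrC (_ ^+ 2)).
Qed.

Lemma cvg_sum_seq I (r : seq I) (u : I -> nat -> R) (l : I -> R) :
  (forall i, u i n @[n --> \oo] --> l i) ->
  \sum_(i <- r) u i n @[n --> \oo] --> \sum_(i <- r) l i.
Proof.
move=> ul; elim: r => [|i r IH].
  by under eq_fun do rewrite big_nil; rewrite big_nil; exact: cvg_cst.
by under eq_fun do rewrite big_cons; rewrite big_cons; exact: cvgD.
Qed.

Lemma cvg_dot (x : nat -> 'rV[R]_d) (y : 'rV[R]_d) :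
  (forall i, x n ord0 i @[n --> \oo] --> y ord0 i) ->
  dot (x n) (x n) @[n --> \oo] --> dot y y.
Proof. by move=> xy; apply: cvg_sum_seq => i; exact: cvgM. Qed.

Lemma limn_einf_le_near (u : nat -> \bar R) (l : R) (e : nat -> R) :
  e n @[n --> \oo] --> 0 -> (forall n, u n <= (l + e n)%:E)%E ->
  (limn_einf u <= l%:E)%E.
Proof.
move=> e0 ul; rewrite limn_einf_lim; apply: lime_le; first exact: is_cvg_einfs.
apply: nearW => n; apply/lee_addgt0Pr => eps eps0.
have [N _ HN] := (cvgr0Pnorm_le _).1 e0 _ eps0.
apply: (@le_trans _ _ (u (maxn n N))).
  by apply: ereal_inf_lbound; exists (maxn n N) => //=; exact: leq_maxl.
apply: le_trans (ul _) _; rewrite -EFinD lee_fin lerD2l.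
by apply: le_trans (ler_norm _) (HN _ _); exact: leq_maxr.
Qed.

(** Fatou's lemma along a sequence that converges almost everywhere: the limit
    is square integrable and no farther from [g]. *)
Lemma weighted_fatou (f : nat -> process Omega R T d) g v (delta : R)
    (e : nat -> R) :
  (forall n, weighted_L2 (g - f n)) ->
  (forall t i, measurable_fun setT (fun w => (g - v) t w ord0 i)) ->
  (\forall w \ae P, forall t i, f n t w ord0 i @[n --> \oo] --> v t w ord0 i) ->
  e n @[n --> \oo] --> 0 ->
  (forall n, weighted_inner (g - f n) (g - f n) <= delta + e n) ->
  weighted_L2 (g - v) /\ weighted_inner (g - v) (g - v) <= delta.
Proof.
move=> Lgf mgv fv e0 fe.
pose h n w := (weighted_dot (g - f n) (g - f n) w)%:E.
have h0 n w : (0 <= h n w)%E by rewrite lee_fin weighted_dot_ge0.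
have mh n : measurable_fun setT (h n).
  by apply/measurable_EFinP; have [m _] := Lgf n; exact: measurable_weighted_dot.
have mgvE : measurable_fun setT (fun w => (weighted_dot (g - v) (g - v) w)%:E).
  by apply/measurable_EFinP; exact: measurable_weighted_dot.
have lim_h : \forall w \ae P,
    limn_einf (h ^~ w) = (weighted_dot (g - v) (g - v) w)%:E.
  apply: filterS fv => w fvw.
  suff : h n w @[n --> \oo] --> (weighted_dot (g - v) (g - v) w)%:E.
    by move=> /cvg_limn_einf_sup[].
  apply: cvg_EFin; first exact: nearW.
  apply: cvg_sum_seq => t; apply: cvgM; first exact: cvg_cst.
  apply: cvg_dot => i.
  have E (x y : process Omega R T d) :
    (x - y) t w ord0 i = x t w ord0 i - y t w ord0 i by rewrite !mxE.
  under eq_fun do rewrite E.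
  by rewrite E; apply: cvgB => //; exact: cvg_cst.
have mlim : measurable_fun setT (fun w => limn_einf (h ^~ w)).
  apply: measurableT_comp => //; apply: measurable_fun_limn_esup => n.
  exact: measurableT_comp.
have le_delta : (\int[P]_w (weighted_dot (g - v) (g - v) w)%:E <= delta%:E)%E.
  rewrite (ae_eq_integral (fun w => limn_einf (h ^~ w))) //; last first.
    by apply: filterS lim_h => w -> _.
  apply: le_trans (fatou _ _ mh _) _ => //.
  apply: limn_einf_le_near e0 _ => n.
  by rewrite weighted_innerE// lee_fin.
have Lgv : weighted_L2 (g - v).
  split => //; apply/integrableP; split => //.
  apply: le_lt_trans (_ : _ <= delta%:E)%E (ltry _).
  apply: le_trans le_delta; rewrite le_eqVlt; apply/orP; left; apply/eqP.
  by apply: eq_integral => w _; rewrite gee0_abs// lee_fin weighted_dot_ge0.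
by split => //; rewrite -lee_fin -weighted_innerE.
Qed.

(** Dominated convergence for the indicators of the exceptional events. *)
Lemma ae_cvg_in_measure (f : nat -> process Omega R T d)
    (v : process Omega R T d) (eps : R) :
  (forall n t i, measurable_fun setT (fun w => f n t w ord0 i)) ->
  (forall t i, measurable_fun setT (fun w => v t w ord0 i)) ->
  (\forall w \ae P, forall t i, f n t w ord0 i @[n --> \oo] --> v t w ord0 i) ->
  0 < eps ->
  P [set w | eps < \sum_(t < T.+1) enorm (f n t w - v t w)]
    @[n --> \oo] --> 0%E.
Proof.
move=> mf mv fv eps0.
pose X n w : R := \sum_(t < T.+1) enorm (f n t w - v t w).
have mX n : measurable_fun setT (X n).
  apply: measurable_sum => t; apply: measurableT_comp.
    by apply: continuous_measurable_fun; exact: sqrt_continuous.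
  have m i : measurable_fun setT (fun w => (f n t w - v t w) ord0 i).
    by under eq_fun do rewrite !mxE; exact: measurable_funB.
  exact: measurable_dot.
pose A n := [set w | eps < X n w].
have mA n : measurable (A n).
  have := mX n measurableT _ (measurable_itv `]eps, +oo[).
  by rewrite setTI; congr (measurable _); apply/seteqP; split => w /=;
    rewrite in_itv/= andbT.
have Xto0 : \forall w \ae P, X n w @[n --> \oo] --> 0.
  apply: filterS fv => w fvw.
  suff : X n w @[n --> \oo] --> \sum_(t < T.+1) (0 : R) by rewrite big1.
  apply: cvg_sum_seq => t.
  suff : enorm (f n t w - v t w) @[n --> \oo] --> Num.sqrt (@dot R d 0 0).
    by rewrite dot0r sqrtr0.
  apply: (continuous_cvg _ (@sqrt_continuous R _)).
  apply: cvg_dot => i; under eq_fun do rewrite !mxE; rewrite mxE.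
  suff : f n t w ord0 i - v t w ord0 i @[n --> \oo] -->
      v t w ord0 i - v t w ord0 i by rewrite subrr.
  by apply: cvgB => //; exact: cvg_cst.
have [] := @dominated_convergence _ _ _ P setT measurableT
  (fun n w => (\1_(A n) w)%:E) (cst 0%E) (cst 1%E).
- by move=> n; apply/measurable_EFinP; exact: measurable_indic.
- exact: measurable_cst.
- apply: filterS Xto0 => w Xw _.
  apply: cvg_near_cst; have [N _ HN] := (cvgr0Pnorm_le _).1 Xw _ eps0.
  exists N => // n Nn; rewrite indicE memNset// /A /=; apply/negP; rewrite -leNgt.
  exact: le_trans (ler_norm _) (HN _ Nn).
- exact: (finite_measure_integrable_cst P 1).
- apply: aeW => w n _; rewrite /= indicE.
  by case: (_ \in _); rewrite ?normr1 ?normr0 ?lee_fin.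
move=> _ _; rewrite integral0; apply: cvg_trans; apply: near_eq_cvg.
by apply: nearW => n; rewrite /= integral_indic// setIT.
Qed.

End WeightedL2.

(** * The cone of superhedgeable processes *)

Section Superhedging.
Context (disp : measure_display) (Omega : measurableType disp) (R : realType).
Context (P : probability Omega R) (T d : nat).
Context (F : 'I_T.+1 -> set (set Omega)) (filtration_F : filtration F).
Context (K : set_process Omega R T d) (K_in : C_valued P F K).
Implicit Types (Z V xi theta : process Omega R T d).

Let sF t : sigma_algebra setT (F t). Proof. by case: filtration_F. Qed.
Let Fm t : F t `<=` measurable. Proof. by case: filtration_F. Qed.
Let Fmono (s t : 'I_T.+1) : (s <= t)%N -> F s `<=` F t.
Proof. by case: filtration_F => _ _; exact. Qed.

Lemma C_valued_cone t : \forall w \ae P,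
  [/\ K t w 0, forall x y, K t w x -> K t w y -> K t w (x + y) &
      forall k x, 0 <= k -> K t w x -> K t w (k *: x)].
Proof.
have [X aX KX] := K_in; apply: filterS (KX t) => w [_ _ ->].
by split; [exact: cone0|exact: coneD|exact: coneZ].
Qed.

Lemma L0_processE theta : L0_process P F (cst setT) theta <->
  forall t i, measurable_wrt (F t) (fun w => theta t w ord0 i).
Proof.
split=> [a t i|m t]; first by case: (a t).
by split; [exact: m|exact: aeW].
Qed.

Lemma superhedgeableP x theta : superhedgeable P F x K theta <->
  L0_process P F (cst setT) theta /\ exists xi,
    [/\ L0_process P F (cst setT) xi,
        forall t, \forall w \ae P, K t w (- xi t w) &
        forall t, \forall w \ae P, K t w (wealth x xi t w - theta t w)].
Proof.
split=> [[ath [_ [xi [axi Kxi] <-] KV]]|[ath [xi [axi Kxi KV]]]].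
  by split => //; exists xi.
by split => //; exists (wealth x xi) => //; exists xi.
Qed.

Lemma wealthD x y xi xi' t w :
  wealth (x + y) (xi + xi') t w = wealth x xi t w + wealth y xi' t w.
Proof.
rewrite /wealth [RHS]addrACA; congr (_ + _).
by rewrite -big_split.
Qed.

Lemma wealthZ k x xi t w :
  wealth (k *: x) (k *: xi) t w = k *: wealth x xi t w.
Proof. by rewrite /wealth scalerDr scaler_sumr. Qed.

Lemma L0_processD xi theta : L0_process P F (cst setT) xi ->
  L0_process P F (cst setT) theta -> L0_process P F (cst setT) (xi + theta).
Proof.
move=> /L0_processE m1 /L0_processE m2; apply/L0_processE => t i.
have -> : (fun w => (xi + theta) t w ord0 i) =
    (fun w => xi t w ord0 i + theta t w ord0 i).
  by apply/funext => w; exact: mxE.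
by apply: measurable_funD; [exact: m1|exact: m2].
Qed.

Lemma L0_processZ k xi : L0_process P F (cst setT) xi ->
  L0_process P F (cst setT) (k *: xi).
Proof.
move=> /L0_processE m; apply/L0_processE => t i.
have -> : (fun w => (k *: xi) t w ord0 i) = (fun w => k * xi t w ord0 i).
  by apply/funext => w; exact: mxE.
by apply: measurable_funM; [exact: measurable_cst|exact: m].
Qed.

Lemma L0_process0 : L0_process P F (cst setT) (0 : process Omega R T d).
Proof.
apply/L0_processE => t i.
have -> : (fun w => (0 : process Omega R T d) t w ord0 i) = cst 0.
  by apply/funext => w; exact: mxE.
exact: measurable_cst.
Qed.

Lemma superhedgeable0 : superhedgeable P F 0 K 0.
Proof.
apply/superhedgeableP; split; first exact: L0_process0.
exists 0; split; first exact: L0_process0.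
  move=> t; apply: filterS (C_valued_cone t) => w [K0 _ _].
  by rewrite (_ : - _ = 0)//; exact: oppr0.
move=> t; apply: filterS (C_valued_cone t) => w [K0 _ _].
rewrite (_ : _ - _ = 0)// /wealth big1 ?addr0//; exact: subr0.
Qed.

Lemma superhedgeableD x y theta theta' :
  superhedgeable P F x K theta -> superhedgeable P F y K theta' ->
  superhedgeable P F (x + y) K (theta + theta').
Proof.
move=> /superhedgeableP[a1 [xi1 [b1 K1 V1]]].
move=> /superhedgeableP[a2 [xi2 [b2 K2 V2]]].
apply/superhedgeableP; split; first exact: L0_processD.
exists (xi1 + xi2); split; first exact: L0_processD.
  move=> t; apply: filterS3 (C_valued_cone t) (K1 t) (K2 t) => w [_ KD _] k1 k2.
  have := KD _ _ k1 k2; congr (K t w _); exact/esym/opprD.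
move=> t; apply: filterS3 (C_valued_cone t) (V1 t) (V2 t) => w [_ KD _] k1 k2.
have := KD _ _ k1 k2; congr (K t w _); rewrite wealthD addrACA; congr (_ + _).
exact/esym/opprD.
Qed.

Lemma superhedgeableZ k x theta : 0 <= k ->
  superhedgeable P F x K theta -> superhedgeable P F (k *: x) K (k *: theta).
Proof.
move=> k0 /superhedgeableP[a1 [xi1 [b1 K1 V1]]].
apply/superhedgeableP; split; first exact: L0_processZ.
exists (k *: xi1); split; first exact: L0_processZ.
  move=> t; apply: filterS2 (C_valued_cone t) (K1 t) => w [_ _ KZ] k1.
  by have := KZ _ _ k0 k1; congr (K t w _); exact: scalerN.
move=> t; apply: filterS2 (C_valued_cone t) (V1 t) => w [_ _ KZ] k1.
have := KZ _ _ k0 k1; congr (K t w _); rewrite wealthZ; exact: scalerBr.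
Qed.

Lemma superhedgeable_shift x theta : L0_process P F (cst setT) theta ->
  superhedgeable P F 0 K (fun t w => theta t w - x) ->
  superhedgeable P F x K theta.
Proof.
move=> ath /superhedgeableP[a1 [xi1 [b1 K1 V1]]].
apply/superhedgeableP; split => //; exists xi1; split => // t.
apply: filterS (V1 t) => w; congr (K t w _).
by rewrite /wealth add0r opprB addrCA addrA.
Qed.

Lemma superhedgeable_ae x theta theta' : L0_process P F (cst setT) theta' ->
  (forall t, \forall w \ae P, theta t w = theta' t w) ->
  superhedgeable P F x K theta -> superhedgeable P F x K theta'.
Proof.
move=> ath e /superhedgeableP[a1 [xi1 [b1 K1 V1]]].
apply/superhedgeableP; split => //; exists xi1; split => // t.
by apply: filterS2 (e t) (V1 t) => w ->.
Qed.

(** A claim [xi] in [- K t], due at time [t] only, requires no trade: the portfolio 0 already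
    covers it. *)
Lemma superhedgeable_single (t : 'I_T.+1) (xi : Omega -> 'rV[R]_d) :
  (forall i, measurable_wrt (F t) (fun w => xi w ord0 i)) ->
  (\forall w \ae P, K t w (- xi w)) ->
  superhedgeable P F 0 K (fun s w => if s == t then xi w else 0).
Proof.
move=> mxi Kxi; apply/superhedgeableP; split.
  apply/L0_processE => s i; have [->//|_] := eqVneq s t.
  by under eq_fun do rewrite mxE; exact: measurable_cst.
exists 0; split; first exact: L0_process0.
  move=> s; apply: filterS (C_valued_cone s) => w [K0 _ _].
  by rewrite (_ : - _ = 0)//; exact: oppr0.
move=> s; apply: filterS2 (C_valued_cone s) Kxi => w [K0 _ _] k.
rewrite (_ : wealth _ _ _ _ = 0); last by rewrite /wealth big1 ?addr0.
by rewrite sub0r; have [->|] := eqVneq s t; rewrite ?oppr0.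
Qed.

(** The position [xi], acquired at time [t] by a trade in [- K t] and then kept,
    is exactly the portfolio of that single trade. *)
Lemma superhedgeable_held (t : 'I_T.+1) (xi : Omega -> 'rV[R]_d) :
  (forall i, measurable_wrt (F t) (fun w => xi w ord0 i)) ->
  (\forall w \ae P, K t w (- xi w)) ->
  superhedgeable P F 0 K (fun s w => if (t <= s)%N then xi w else 0).
Proof.
move=> mxi Kxi; apply/superhedgeableP; split.
  apply/L0_processE => s i; have [ts|_] := leqP t s.
    exact: measurable_wrt_sub (Fmono ts) (mxi i).
  by under eq_fun do rewrite mxE; exact: measurable_cst.
exists (fun s w => if s == t then xi w else 0); split.
- apply/L0_processE => s i; have [->//|_] := eqVneq s t.
  by under eq_fun do rewrite mxE; exact: measurable_cst.
- move=> s; apply: filterS2 (C_valued_cone s) Kxi => w [K0 _ _] k.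
  by have [->|] := eqVneq s t; rewrite ?oppr0.
move=> s; apply: filterS (C_valued_cone s) => w [K0 _ _].
rewrite (_ : _ - _ = 0)//; apply/eqP; rewrite subr_eq0; apply/eqP.
rewrite /wealth add0r; have [ts|st] := leqP t s.
  rewrite (bigD1 t)//= eqxx big1 ?addr0// => u /andP[_ /negbTE ->//].
by rewrite big1// => u us; case: eqP => // ut; move: st; rewrite -ut ltnNge us.
Qed.

(** It suffices to pair [Y] with the countably many generators of the cone.  For
    a generator [X n], the test position is [- X n], cut down to the event where
    [dot (X n) Y] is negative and normalized to be bounded; its pairing
    with [Y] is then nonnegative, so it vanishes almost everywhere. *)
Lemma polar_of_tests t (Y : Omega -> 'rV[R]_d) :
  (forall i, measurable_wrt (F t) (fun w => Y w ord0 i)) ->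
  (forall xi : Omega -> 'rV[R]_d,
    (forall i, measurable_wrt (F t) (fun w => xi w ord0 i)) ->
    (forall w, dot (xi w) (xi w) <= 1) ->
    (\forall w \ae P, K t w (- xi w)) ->
    (\int[P]_w (dot (xi w) (Y w))%:E <= 0)%E) ->
  \forall w \ae P, polar (K t w) (Y w).
Proof.
move=> mY tests; have [X /(_ _)aX KX] := K_in.
have mX n i : measurable_wrt (F t) (fun w => X n t w ord0 i).
  by case: (aX n t).
suff pos n : \forall w \ae P, 0 <= dot (X n t w) (Y w).
  apply: filterS2 (KX t) (ae_foralln pos) => w [_ _ ->] h.
  by apply: polar_cone => _ [n _ <-].
have mXY : measurable_wrt (F t) (fun w => dot (X n t w) (Y w)).
  by apply: measurable_dot; [exact: mX|exact: mY].
pose A := (fun w => dot (X n t w) (Y w)) @^-1` [set x | x < 0].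
have FA : F t A.
  apply: measurable_wrt_preimage => //.
  by rewrite -set_itvNyo; exact: measurable_itv.
pose den w := 1 + dot (X n t w) (X n t w).
have den1 w : 1 <= den w by rewrite /den lerDl dotvv_ge0.
have den0 w : 0 < den w by exact: lt_le_trans ltr01 (den1 w).
pose lam w : R := \1_A w / den w.
have lam0 w : 0 <= lam w by rewrite divr_ge0 ?indicE ?ler0n// ltW.
have mden : measurable_wrt (F t) den.
  apply: measurable_funD; first exact: measurable_cst.
  by apply: measurable_dot; exact: mX.
have mlam : measurable_wrt (F t) lam.
  apply: measurable_funM.
    by apply: measurable_indic; rewrite measurable_g_measurableTypeE.
  by apply: measurable_fun_inv mden _ => w; rewrite gt_eqF.
pose xi w := - (lam w *: X n t w).
have mxi i : measurable_wrt (F t) (fun w => xi w ord0 i).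
  under eq_fun do rewrite !mxE.
  by apply: measurable_funN; apply: measurable_funM; [exact: mlam|exact: mX].
have dxi w : dot (xi w) (Y w) = - (lam w * dot (X n t w) (Y w)).
  by rewrite /xi dotNl dotZl.
have dxi0 w : 0 <= dot (xi w) (Y w).
  rewrite dxi /lam indicE; have [|_] := boolP (w \in A); last first.
    by rewrite !mul0r oppr0.
  rewrite inE /A /= => /ltW neg; rewrite oppr_ge0 pmulr_rle0// mul1r.
  by rewrite invr_gt0.
have xi1 w : dot (xi w) (xi w) <= 1.
  rewrite /xi dotNl dotNr opprK dotZl dotZr mulrA -expr2.
  have l1 : lam w * den w <= 1.
    by rewrite /lam divfK ?gt_eqF// indicE lern1 leq_b1.
  have l2 : lam w <= 1.
    apply: le_trans l1; rewrite -{1}[lam w]mulr1.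
    exact: ler_wpM2l.
  have x0 := dotvv_ge0 (X n t w); move: l1 l2 (lam0 w); rewrite /den.
  set l := lam w; set x := dot _ _ in x0 *; move=> l1 l2 l0.
  have : l * (l * x) <= 1 * 1 by apply: ler_pM => //; nra.
  by nra.
have Kxi : \forall w \ae P, K t w (- xi w).
  apply: filterS (KX t) => w [_ _ ->]; rewrite opprK.
  by apply: coneZ => //; apply: cone_sub; exists n.
have mint : measurable_fun setT (fun w => (dot (xi w) (Y w))%:E).
  apply/measurable_EFinP/(measurable_wrt_measurable (@Fm t)).
  by apply: measurable_dot; [exact: mxi|exact: mY].
have : (\int[P]_w `|(dot (xi w) (Y w))%:E| = 0)%E.
  apply/eqP; rewrite eq_le; apply/andP; split; last first.
    by apply: integral_ge0 => w _.
  apply: le_trans (tests xi mxi xi1 Kxi).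
  rewrite le_eqVlt; apply/orP; left; apply/eqP; apply: eq_integral => w _.
  by rewrite gee0_abs ?lee_fin.
move/(ae_eq_integral_abs P measurableT mint); apply: filterS => w /(_ I) [].
rewrite dxi => /eqP; rewrite oppr_eq0 mulf_eq0 => /orP[/eqP l0|/eqP ->//].
rewrite leNgt; apply/negP => neg; move: l0; rewrite /lam indicE mem_set//.
by rewrite mul1r => /eqP; rewrite invr_eq0 gt_eqF.
Qed.

(** * Separation by projection *)

Section Projection.
Context (As_closed : closed_in_measure P (superhedgeable P F 0 K)).
Context (theta : process Omega R T d) (x : 'rV[R]_d).
Context (theta_in : L0_process P F (cst setT) theta).

(** The weights are [F t]-measurable, so multiplying by them keeps processes
    adapted, and they make [theta] square integrable. *)
Let rho (t : 'I_T.+1) (w : Omega) : R := (1 + dot (theta t w) (theta t w))^-1.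

Let mtheta t i : measurable_wrt (F t) (fun w => theta t w ord0 i).
Proof. by case: (theta_in t). Qed.

Let den_gt0 t w : 0 < 1 + dot (theta t w) (theta t w).
Proof. by rewrite ltr_wpDr ?dotvv_ge0. Qed.

Let mrhoF t : measurable_wrt (F t) (rho t).
Proof.
apply: measurable_fun_inv => [|w]; last by rewrite gt_eqF.
apply: measurable_funD; first exact: measurable_cst.
by apply: measurable_dot; exact: mtheta.
Qed.

Let mrho t : measurable_fun setT (rho t).
Proof. exact: (measurable_wrt_measurable (@Fm t) (@mrhoF t)). Qed.

Let rho_gt0 t w : 0 < rho t w. Proof. by rewrite invr_gt0. Qed.

Let rho_le1 t w : rho t w <= 1.
Proof. by rewrite invf_le1// lerDl dotvv_ge0. Qed.

Let rho_theta t w : rho t w * dot (theta t w) (theta t w) <= 1.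
Proof. by rewrite mulrC ler_pdivrMr// mul1r lerDr. Qed.

Let excess : process Omega R T d := fun t w => theta t w - x.

Let excess_adapted : L0_process P F (cst setT) excess.
Proof.
apply/L0_processE => t i; rewrite /excess.
under eq_fun do rewrite !mxE.
by apply: measurable_funB; [exact: mtheta|exact: measurable_cst].
Qed.

Let adapted_measurable (f : process Omega R T d) t i :
  L0_process P F (cst setT) f -> measurable_fun setT (fun w => f t w ord0 i).
Proof.
by move=> /L0_processE/(_ t i) m; exact: (measurable_wrt_measurable (@Fm t) m).
Qed.

Let bounded_L2 (f : process Omega R T d) (M : R) :
  (forall t i, measurable_fun setT (fun w => f t w ord0 i)) ->
  (forall t w, rho t w * dot (f t w) (f t w) <= M) -> weighted_L2 P rho f.
Proof.
move=> mf fM; split => //.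
apply: (@le_integrable _ _ _ _ _ measurableT _
  (fun w => (cst (\sum_(t < T.+1) M) w)%:E)).
- by apply/measurable_EFinP; exact: measurable_weighted_dot.
- move=> w _ /=; rewrite lee_fin [leLHS]ger0_norm ?weighted_dot_ge0//.
  apply: le_trans (ler_norm _); apply: ler_sum => t _; exact: fM.
- exact: finite_measure_integrable_cst.
Qed.

Let excess_L2 : weighted_L2 P rho excess.
Proof.
apply: (@bounded_L2 _ (3 + 3 * dot x x)) => [t i|t w].
  exact: adapted_measurable.
rewrite /excess dotDl !dotDr !dotNl !dotNr opprK (dotC x (theta t w)).
have := dot_le (theta t w) x; rewrite ler_norml => /andP[h _].
have x0 := dotvv_ge0 x; have t0 := dotvv_ge0 (theta t w).
have r0 := ltW (rho_gt0 t w); have r1 := rho_le1 t w; have r2 := rho_theta t w.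
move: h x0 t0 r0 r1 r2; set r := rho t w; set a := dot x x.
set b := dot (theta t w) _; set c := dot (theta t w) x => h x0 t0 r0 r1 r2.
apply: (@le_trans _ _ (r * (3 * b + 3 * a))); first by rewrite ler_wpM2l//; lra.
have : r * a <= 1 * a by rewrite ler_wpM2r.
by rewrite mulrDr !(mulrCA r); lra.
Qed.

Let hedges := superhedgeable P F 0 K `&` weighted_L2 P rho.

(** The almost everywhere limit of the sequence is also its limit in measure,
    hence almost surely equal to a superhedgeable process, and Fatou's lemma
    bounds its distance to the excess. *)
Lemma hedges_complete (c : nat -> process Omega R T d) (delta : R) :
  (forall n, hedges (c n)) ->
  (forall n, weighted_inner P rho (excess - c n) (excess - c n) <=
     delta + 8^-1 ^+ n) ->
  (forall n, weighted_inner P rho (c n.+1 - c n) (c n.+1 - c n) <=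
     4 * 8^-1 ^+ n) ->
  exists2 p, hedges p &
    weighted_inner P rho (excess - p) (excess - p) <= delta.
Proof.
move=> Cc near_c fast_c.
have Lc n : weighted_L2 P rho (c n) by case: (Cc n).
have mc n t i : measurable_fun setT (fun w => c n t w ord0 i) by case: (Lc n).
pose v : process Omega R T d := fun t w =>
  \row_i fine (limn_esup (fun n => (c n t w ord0 i)%:E)).
have mv t i : measurable_fun setT (fun w => v t w ord0 i).
  under eq_fun do rewrite mxE.
  apply: measurableT_comp => //; apply: measurable_fun_limn_esup => n.
  exact/measurable_EFinP.
have cv : \forall w \ae P, forall t i, c n t w ord0 i @[n --> \oo] --> v t w ord0 i.
  apply: filterS (fast_cauchy_ae_cvg (@mrho) rho_gt0 Lc fast_c) => w cw t i.
  have /cvg_ex[l cl] := cw t i; rewrite mxE.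
  have clE : (c n t w ord0 i)%:E @[n --> \oo] --> l%:E.
    by apply: cvg_EFin => //; exact: nearW.
  by rewrite (cvg_limn_einf_sup clE).2.
have [|t|eps eps0|u Cu uv] := As_closed (v := c) (v0 := v).
- by move=> n; case: (Cc n).
- split; last exact: aeW.
  move=> i; move: (mv t i); rewrite /measurable_wrt => m _ B mB.
  have := m measurableT B mB; exact: sub_sigma_algebra.
- by apply: ae_cvg_in_measure.
have au : L0_process P F (cst setT) u by case: Cu.
have cu : \forall w \ae P, forall t i, c n t w ord0 i @[n --> \oo] --> u t w ord0 i.
  have uv' : \forall w \ae P, forall t, u t w = v t w by apply: filter_forall.
  by apply: filterS2 cv uv' => w cw uvw t i; rewrite uvw; exact: cw.
have e0 : (8^-1 : R) ^+ n @[n --> \oo] --> 0.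
  rewrite exprn_geometric; apply: cvg_geometric.
  by rewrite ger0_norm ?invr_ge0 ?invf_lt1 ?ltr1n ?ler0n.
have Lec n : weighted_L2 P rho (excess - c n) by exact: weighted_L2B.
have meu t i : measurable_fun setT (fun w => (excess - u) t w ord0 i).
  have -> : (fun w => (excess - u) t w ord0 i) =
      (fun w => excess t w ord0 i - u t w ord0 i).
    by apply/funext => w; rewrite !mxE.
  by apply: measurable_funB; exact: adapted_measurable.
have [Leu le_delta] := weighted_fatou (@mrho) rho_gt0 Lec meu cu e0 near_c.
exists u => //; split => //.
have -> : u = excess - (excess - u) by rewrite opprB addrC subrK.
exact: weighted_L2B.
Qed.

Lemma hedges_projection : exists2 p, hedges p &
  (forall c, hedges c -> weighted_inner P rho (excess - p) c <= 0) /\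
  weighted_inner P rho (excess - p) p = 0.
Proof.
apply: (cone_projection (L := weighted_L2 P rho) (C := hedges)).
- by move=> u v; exact: weighted_L2D.
- by move=> k u; exact: weighted_L2Z.
- by move=> u v; exact: weighted_innerC.
- by move=> u v w; exact: weighted_innerDl.
- by move=> k u v; exact: weighted_innerZl.
- by move=> u; exact: weighted_inner_ge0.
- exact: excess_L2.
- by move=> u [].
- split; first exact: superhedgeable0.
  rewrite (_ : 0 = 0 *: excess); first exact: weighted_L2Z.
  by rewrite scale0r.
- move=> u v [Cu Lu] [Cv Lv]; split; last exact: weighted_L2D.
  by have := superhedgeableD Cu Cv; rewrite addr0.
- move=> k u k0 [Cu Lu]; split; last exact: weighted_L2Z.
  by have := superhedgeableZ k0 Cu; rewrite scaler0.
- exact: hedges_complete.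
Qed.

(** The residual of the projection, multiplied by the weights, is a dual process;
    the dual inequality for it forces the residual to vanish. *)
Lemma superhedgeable_of_dual :
  (forall t, \forall w \ae P, @orthant R d `\` [set 0] `<=` interior (K t w)) ->
  (forall Z, calD P F K Z ->
     L1_real_process P F (fun t => (fun w => dot (Z t w) (theta t w))^\-) ->
     \forall w \ae P,
       (\int[P]_w' (\sum_(t < T.+1) dot (theta t w') (Z t w'))%:E
        <= (dot (Zbar P F Z ord0 w) x)%:E)%E) ->
  superhedgeable P F x K theta.
Proof.
move=> K_int dual.
have [p [Cp Lp] [test orth]] := hedges_projection.
have ap : L0_process P F (cst setT) p by case: Cp.
pose r := excess - p.
have Lr : weighted_L2 P rho r by exact: weighted_L2B.
have ar : L0_process P F (cst setT) r.
  by apply: L0_processD => //; rewrite -scaleN1r; exact: L0_processZ.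
have [_ irr] := Lr.
pose Z t w := rho t w *: r t w.
have ZE c w : weighted_dot rho r c w = \sum_(t < T.+1) dot (Z t w) (c t w).
  by apply: eq_bigr => t _; rewrite dotZl.
have mZ t i : measurable_wrt (F t) (fun w => Z t w ord0 i).
  under eq_fun do rewrite mxE.
  by apply: measurable_funM; [exact: mrhoF|case: (ar t) => m _; exact: m].
have term_le t w : rho t w * dot (r t w) (r t w) <= weighted_dot rho r r w.
  rewrite /weighted_dot (bigD1 t)//= lerDl; apply: sumr_ge0 => s _.
  by rewrite mulr_ge0 ?dotvv_ge0// ltW.
have i1rr : P.-integrable setT (EFin \o (fun w => cst 1 w + weighted_dot rho r r w)).
  by apply: integrable_fctD => //; exact: (finite_measure_integrable_cst P 1).
have wd0 w : 0 <= weighted_dot rho r r w by exact: weighted_dot_ge0.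
have iZ t i : P.-integrable setT (EFin \o (fun w => Z t w ord0 i)).
  apply: (le_integrable measurableT _ _ i1rr).
    by apply/measurable_EFinP; exact: (measurable_wrt_measurable (@Fm t) (mZ t i)).
  move=> w _ /=; rewrite lee_fin [leRHS]ger0_norm ?addr_ge0//.
  rewrite mxE normrM gtr0_norm//.
  apply: (@le_trans _ _ (1 + rho t w * dot (r t w) (r t w))); last first.
    by rewrite lerD2l.
  apply: le_trans (lerD (rho_le1 t w) (lexx _)).
  rewrite -[X in _ <= X + _]mulr1 -mulrDr ler_wpM2l//; first exact: ltW.
  exact: norm_le_dot.
have test_le c : hedges c ->
    (\int[P]_w (\sum_(t < T.+1) dot (Z t w) (c t w))%:E <= 0)%E.
  move=> Cc; have irc := integrable_weighted_dot mrho rho_gt0 Lr Cc.2.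
  under eq_integral do rewrite -ZE.
  rewrite -[X in (X <= _)%E]fineK; last exact: integrable_fin_num.
  by rewrite lee_fin; exact: (test c Cc).
have bounded_hedge (b : 'I_T.+1 -> bool) (xi : Omega -> 'rV[R]_d) :
    (forall w, dot (xi w) (xi w) <= 1) ->
    superhedgeable P F 0 K (fun s w => if b s then xi w else 0) ->
    hedges (fun s w => if b s then xi w else 0).
  move=> xi1 Cc; split => //; apply: (@bounded_L2 _ 1).
    by have [ac _] := Cc => t i; have := @adapted_measurable _ t i ac; exact.
  move=> t w; case: (b t); last by rewrite dot0l mulr0.
  rewrite -[leRHS]mulr1; apply: ler_pM => //; last exact: dotvv_ge0.
  exact: ltW.
(* Positions held at time t only. *)
have pZ t : \forall w \ae P, polar (K t w) (Z t w).
  apply: polar_of_tests (mZ t) _ => xi mxi xi1 Kxi.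
  have Cc := bounded_hedge (fun s => s == t) _ xi1 (superhedgeable_single mxi Kxi).
  have := test_le _ Cc; congr (_ <= _)%E; apply: eq_integral => w _.
  rewrite (bigD1 t)//= eqxx big1 ?addr0; first by rewrite dotC.
  by move=> s /negbTE ->; rewrite dot0r.
(* Positions bought at time t and held until the horizon. *)
have pZb t : \forall w \ae P, polar (K t w) (Zbar P F Z t w).
  apply: polar_of_tests => [i|xi mxi xi1 Kxi].
    by case: (Zbar_condexp filtration_F iZ t i).
  have Cc := bounded_hedge (fun s => (t <= s)%N) _ xi1 (superhedgeable_held mxi Kxi).
  have xiM w i : `|xi w ord0 i| <= 1.
    rewrite -(@expr_le1 _ 2)// real_normK ?num_real//.
    exact: le_trans (sqr_le_dot _ _) (xi1 w).
  have [_ ->] := integral_dot_Zbar filtration_F iZ mxi xiM ler01.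
  have := test_le _ Cc; congr (_ <= _)%E; apply: eq_integral => w _.
  rewrite dot_sumr [in RHS]big_mkcond/=; congr EFin; apply: eq_bigr => s _.
  by case: ifP => _; [rewrite dotC|rewrite dot0r].
have DZ : calD P F K Z.
  split; last by move=> t; split; [exact: pZ|exact: pZb].
  split; last exact: iZ.
  move=> t; split; first exact: mZ.
  apply: filterS2 (pZ t) (K_int t) => w pw kw i.
  (* Nonnegativity of Z: the unit vectors belong to the cones. *)
  have e0 : (@orthant R d `\` [set 0]) (delta_mx ord0 i).
    split => [j|/matrixP/(_ ord0 i)].
      by rewrite !mxE; case: (_ && _).
    by rewrite !mxE !eqxx/= => /eqP; rewrite oner_eq0.
  have := pw _ (interior_subset (kw _ e0)).
  rewrite /dot (bigD1 i)//= mxE !eqxx mul1r big1 ?addr0// => j ji.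
  by rewrite mxE eqxx (negbTE ji) mul0r.
have iZth t : P.-integrable setT (EFin \o (fun w => dot (Z t w) (theta t w))).
  apply: (le_integrable measurableT _ _ i1rr).
    apply/measurable_EFinP/(measurable_wrt_measurable (@Fm t)).
    by apply: measurable_dot; [exact: mZ|exact: mtheta].
  move=> w _ /=; rewrite lee_fin [leRHS]ger0_norm ?addr_ge0//.
  rewrite /Z dotZl normrM gtr0_norm//.
  apply: le_trans (ler_wpM2l (ltW (rho_gt0 t w)) (dot_le _ _)) _.
  rewrite mulrDr addrC; apply: lerD; [exact: rho_theta|exact: term_le].
have negZ : L1_real_process P F (fun t => (fun w => dot (Z t w) (theta t w))^\-).
  move=> t; split.
    apply: measurable_funrneg.
    by apply: measurable_dot; [exact: mZ|exact: mtheta].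
  exact: integrable_funrneg.
have := dual Z DZ negZ.
pose G w := \sum_(t < T.+1) dot (theta t w) (Z t w).
pose H w := dot x (\sum_(s < T.+1 | (@ord0 T <= s)%N) Z s w).
have iG : P.-integrable setT (EFin \o G).
  apply: integrable_fct_sum => t _; under eq_fun do rewrite dotC.
  exact: iZth.
have xM (w : Omega) i : `|x ord0 i| <= \sum_(j < d) `|x ord0 j|.
  by rewrite (bigD1 i)//= lerDl sumr_ge0.
have M0 : 0 <= \sum_(j < d) `|x ord0 j| by rewrite sumr_ge0.
have mx i : measurable_wrt (F ord0) (fun _ : Omega => x ord0 i).
  exact: measurable_cst.
have [iZb EZb] := integral_dot_Zbar filtration_F iZ mx xM M0.
have iH : P.-integrable setT (EFin \o H).
  have -> : H = (fun w => \sum_(s < T.+1) \sum_(i < d) x ord0 i * Z s w ord0 i).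
    by apply/funext => w; rewrite /H dot_sumr.
  apply: integrable_fct_sum => s _; apply: integrable_fct_sum => i _.
  exact: integrable_fctZ.
rewrite -/G => le_ae.
(* The right-hand side of the dual inequality is random; integrating the
   inequality replaces Zbar by the sum of the Z s. *)
have GH : (\int[P]_w (G w)%:E <= \int[P]_w (H w)%:E)%E.
  rewrite -EZb -[leLHS]fineK; last exact: integrable_fin_num.
  have [] := @ae_le_integral _ _ _ P (cst (fine (\int[P]_w (G w)%:E)%E))
    (fun w => dot x (Zbar P F Z ord0 w)).
  - exact: measurable_cst.
  - by apply/measurable_EFinP; exact: measurable_int iZb.
  - apply: filterS le_ae => w; rewrite dotC -[leLHS]fineK ?lee_fin//.
    exact: integrable_fin_num.
  move=> _; rewrite -[X in (X <= _)%E -> _]/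
    (\int[P]_w cst (fine (\int[P]_w (G w)%:E)%E)%:E w)%E.
  by rewrite integral_cst// [X in (_ * X)%E]probability_setT mule1.
have rexc : weighted_inner P rho r excess <= 0.
  rewrite /weighted_inner /Rintegral.
  have E w : weighted_dot rho r excess w = G w - H w.
    rewrite ZE /G /H dot_sumr -sumrB; apply: eq_bigr => t _.
    by rewrite /excess dotDr dotNr dotC (dotC _ x).
  under eq_integral do rewrite E EFinB.
  rewrite integralB_EFin// fineB ?integrable_fin_num// subr_le0.
  by apply: fine_le => //; exact: integrable_fin_num.
have rr0 : weighted_inner P rho r r = 0.
  apply/eqP; rewrite eq_le weighted_inner_ge0// andbT.
  apply: le_trans rexc; have -> : excess = r + p by rewrite /r subrK.
  suff -> : weighted_inner P rho r (r + p) = weighted_inner P rho r r by [].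
  rewrite weighted_innerC weighted_innerDl// [X in _ + X]weighted_innerC.
  by rewrite orth addr0.
have ae0 : \forall w \ae P, weighted_dot rho r r w = 0.
  have mrr := measurable_int _ irr.
  have : (\int[P]_w `|(weighted_dot rho r r w)%:E| = 0)%E.
    under eq_integral do rewrite gee0_abs ?lee_fin//.
    by rewrite weighted_innerE// rr0.
  move/(ae_eq_integral_abs P measurableT mrr); apply: filterS => w /(_ I).
  by case.
apply: superhedgeable_shift => //; apply: superhedgeable_ae Cp => // t.
apply: filterS ae0 => w rw; have r0 : r t w = 0.
  apply/rowP => i; rewrite [RHS]mxE; apply/eqP; rewrite -sqrf_eq0 eq_le sqr_ge0 andbT.
  rewrite -(pmulr_rle0 _ (rho_gt0 t w)) -rw.
  exact: sqr_le_weighted_dot.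
have : excess t w - p t w = 0 by exact: r0.
by move/eqP; rewrite subr_eq0 => /eqP.
Qed.

End Projection.
End Superhedging.

Theorem mainTheorem2 (disp : measure_display) (Omega : measurableType disp)
    (R : realType) (P : probability Omega R)
    (complete_P : measure_is_complete P)
    (T : nat) (T_ge1 : (1 <= T)%N) (d : nat) (d_ge1 : (1 <= d)%N)
    (F : 'I_T.+1 -> set (set Omega))
    (filtration_F : filtration F)
    (F_T : F ord_max = measurable)
    (F_0 : trivial_sigma_algebra P (F ord0))
    (K : set_process Omega R T d) (K_in : calK P F K)
    (As_closed : closed_in_measure P (superhedgeable P F 0 K))
    (no_arbitrage :
       attainable_at P F ord_max 0 K `&` L0 P measurable (cst (@orthant R d))
       = L0 P measurable (cst [set 0]))
    (theta : process Omega R T d) (theta_in : L0_process P F (cst setT) theta) :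
  Gamma P F theta K =
  [set x : 'rV[R]_d |
     forall Z : process Omega R T d, calD P F K Z ->
       L1_real_process P F (fun t => (fun w => dot (Z t w) (theta t w))^\-) ->
       \forall w \ae P,
         ('E_P[fun w' => (\sum_(t < T.+1) dot (theta t w') (Z t w'))%R]
          <= (dot (Zbar P F Z ord0 w) x)%:E)%E].
Proof.
have [sF Fm _] := filtration_F; have [CK K_int] := K_in.
rewrite /Gamma; apply/seteqP; split => x /=.
  move=> /superhedgeableP[_ [xi [axi Kxi KV]]] Z [[aZ iZ] polZ] negZ.
  have mZ t i : measurable_wrt (F t) (fun w => Z t w ord0 i).
    by case: (aZ t) => + _; apply.
  have mZb i : measurable_wrt (F ord0) (fun w => Zbar P F Z ord0 w ord0 i).
    by case: (Zbar_condexp filtration_F iZ ord0 i).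
  have le_int := superhedge_integral_le filtration_F iZ mZ (fun t => (polZ t).1)
    (fun t => (polZ t).2) axi Kxi theta_in KV (fun t => (negZ t).2).
  have mxZ : measurable_wrt (F ord0) (fun w => dot x (Zbar P F Z ord0 w)).
    by apply: measurable_dot => //= i; exact: measurable_cst.
  have ixZ : P.-integrable setT (EFin \o (fun w => dot x (Zbar P F Z ord0 w))).
    apply: integrable_fct_sum => i _; apply: integrable_fctZ.
    by case: (Zbar_condexp filtration_F iZ ord0 i).
  apply: filterS (trivial_integral_le (sF _) (Fm _) F_0 mxZ ixZ) => w le_w.
  by rewrite unlock dotC; exact: le_trans le_int le_w.
move=> dual; apply: (superhedgeable_of_dual filtration_F CK As_closed theta_in K_int).
move=> Z DZ negZ; apply: filterS (dual Z DZ negZ) => w.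
by rewrite unlock.
Qed.
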